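(* Let $e,e'$ be resource expressions with $e\asymp e'$. If $\mathrm{supp}(\mathrm{NF}(e))\cap\mathrm{supp}(\mathrm{NF}(e'))\ne\emptyset$ then $e=e'$.
   Context: Resource terms and monomials: $s,t ::= x\mid\lambda x.s\mid\langle s\rangle\bar t\mid s\oplus\bullet\mid\bullet\oplus s$, $\bar t::=[t_1,\dots,t_n]$ (finite multisets of resource terms), up to $\alpha$-equivalence; a resource expression is a term or a monomial. Finite formal sums of resource terms (resp. monomials) with coefficients in $\mathbb N$, supports $\mathrm{supp}(E)$; constructors extended by multilinearity. For $\bar u=[u_1,\dots,u_n]$, $\partial_xe\cdot\bar u$ is defined by: $\partial_xy\cdot\bar u$ is $y$ if $y\ne x$ and $n=0$, $u_1$ if $y=x$ and $n=1$, $0$ otherwise; it commutes with $\lambda y.$ ($y$ fresh), $-\oplus\bullet$, $\bullet\oplus-$; $\partial_x(\langle s\rangle\bar t)\cdot\bar u=\sum_{(I_1,I_2)}\langle\partial_xs\cdot\bar u_{I_1}\rangle(\partial_x\bar t\cdot\bar u_{I_2})$; $\partial_x[t_1,\dots,t_k]\cdot\bar u=\sum_{(I_1,\dots,I_k)}[\partial_xt_1\cdot\bar u_{I_1},\dots,\partial_xt_k\cdot\bar u_{I_k}]$, sums over tuples of pairwise disjoint possibly empty subsets of $\{1,\dots,n\}$ covering it, $\bar u_I=[u_i\mid i\in I]$. The reduction $\to_\partial$ is generated by $\langle\lambda x.s\rangle\bar t\to_\partial\partial_xs\cdot\bar t$, $\langle s\oplus\bullet\rangle\bar t\to_\partial(\langle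 s\rangle\bar t)\oplus\bullet$, $\langle\bullet\oplus s\rangle\bar t\to_\partial\bullet\oplus\langle s\rangle\bar t$, $\lambda x.(s\oplus\bullet)\to_\partial(\lambda x.s)\oplus\bullet$, $\lambda x.(\bullet\oplus s)\to_\partial\bullet\oplus\lambda x.s$, closed under all contexts and extended to sums by $e+F\to_\partial E'+F$ when $e\to_\partial E'$; it is confluent and strongly normalizing and $\mathrm{NF}(E)$ denotes the normal form. The coherence $\asymp$ on resource expressions: $x\asymp x$; $\lambda x.s\asymp\lambda x.s'$ if $s\asymp s'$; $\langle s\rangle\bar t\asymp\langle s'\rangle\bar t'$ if $s\asymp s'$ and $\bar t\asymp\bar t'$; $[t_1,\dots,t_n]\asymp[t_{n+1},\dots,t_{n+m}]$ if $t_i\asymp t_j$ for all $1\le i,j\le n+m$; $s\oplus\bullet\asymp s'\oplus\bullet$ and $\bullet\oplus s\asymp\bullet\oplus s'$ if $s\asymp s'$; $s\oplus\bullet\asymp\bullet\oplus s'$ for all $s,s'$ (the relation is symmetric). *)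

(* Defs.v *)
From Stdlib Require Import Arith List Lia Wf_nat Relations.
From Stdlib Require Import SetoidPermutation RelationClasses.
Import ListNotations.

(** Representatives of resource terms: variables are de Bruijn indices, so that
    alpha-equivalence is syntactic identity; a monomial is a list of terms, to
    be read up to the permutations of [teq] below.  [Var i] with [i] at least
    the number of enclosing binders is a free variable. *)
Inductive term : Type :=
| Var (i : nat)
| Lam (s : term)
| App (s : term) (ts : list term)
| ChL (s : term)  (* s (+) * *)
| ChR (s : term). (* * (+) s *)

Inductive expr : Type :=
| Term (t : term)
| Mono (ts : list term).

Definition term_nested_ind (P : term -> Prop)
  (HV : forall i, P (Var i))
  (HL : forall s, P s -> P (Lam s))
  (HA : forall s ts, P s -> Forall P ts -> P (App s ts))
  (Hl : forall s, P s -> P (ChL s))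
  (Hr : forall s, P s -> P (ChR s)) : forall t, P t :=
  fix go t := match t with
  | Var i => HV i
  | Lam s => HL s (go s)
  | App s ts => HA s ts (go s)
      ((fix gos us : Forall P us := match us with
        | [] => Forall_nil _
        | u :: us' => Forall_cons u (go u) (gos us')
        end) ts)
  | ChL s => Hl s (go s)
  | ChR s => Hr s (go s)
  end.

(** ** Equality of resource terms and expressions *)

Inductive teq : term -> term -> Prop :=
| teq_var i : teq (Var i) (Var i)
| teq_lam s s' : teq s s' -> teq (Lam s) (Lam s')
| teq_app s s' ts ts' :
    teq s s' -> PermutationA teq ts ts' -> teq (App s ts) (App s' ts')
| teq_chl s s' : teq s s' -> teq (ChL s) (ChL s')
| teq_chr s s' : teq s s' -> teq (ChR s) (ChR s').

Inductive eeq : expr -> expr -> Prop :=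
| eeq_term t t' : teq t t' -> eeq (Term t) (Term t')
| eeq_mono ts ts' : PermutationA teq ts ts' -> eeq (Mono ts) (Mono ts').

Lemma teq_refl t : teq t t.
Proof.
  induction t as [i|s IH|s ts IH IHs|s IH|s IH] using term_nested_ind;
    constructor; auto.
  induction IHs; constructor; auto.
Qed.

Fixpoint teq_sym t t' (H : teq t t') {struct H} : teq t' t.
Proof.
  destruct H as [i|s s' H|s s' ts ts' H Hs|s s' H|s s' H]; constructor; auto.
  revert ts ts' Hs. fix IH 3. intros ts ts' Hs.
  destruct Hs as [|x x' l l' Hx Hl|x y l|l l' l'' H1 H2].
  - constructor.
  - constructor; [exact (teq_sym _ _ Hx)|exact (IH _ _ Hl)].
  - apply permA_swap.
  - exact (permA_trans (IH _ _ H2) (IH _ _ H1)).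
Qed.

Lemma teq_trans t t' t'' : teq t t' -> teq t' t'' -> teq t t''.
Proof.
  intros H. revert t''. induction H; intros t'' H'; inversion H'; subst;
    constructor; auto.
  eapply permA_trans; eassumption.
Qed.

Global Instance teq_equiv : Equivalence teq.
Proof. split; [exact teq_refl|exact teq_sym|exact teq_trans]. Qed.

Global Instance eeq_equiv : Equivalence eeq.
Proof.
  split.
  - intros [t|ts]; constructor; reflexivity.
  - intros e e' [t t' H|ts ts' H]; constructor; now symmetry.
  - intros e e' e'' [t t' H|ts ts' H] H'; inversion H'; subst; constructor;
      etransitivity; eassumption.
Qed.

(** ** Coherence *)

Inductive tcoh : term -> term -> Prop :=
| tcoh_var i : tcoh (Var i) (Var i)
| tcoh_lam s s' : tcoh s s' -> tcoh (Lam s) (Lam s')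
| tcoh_app s s' ts ts' :
    tcoh s s' -> mcoh ts ts' -> tcoh (App s ts) (App s' ts')
| tcoh_chl s s' : tcoh s s' -> tcoh (ChL s) (ChL s')
| tcoh_chr s s' : tcoh s s' -> tcoh (ChR s) (ChR s')
| tcoh_chlr s s' : tcoh (ChL s) (ChR s')
| tcoh_chrl s s' : tcoh (ChR s) (ChL s')
with mcoh : list term -> list term -> Prop :=
| mcoh_intro ts ts' :
    (forall t u, In t (ts ++ ts') -> In u (ts ++ ts') -> tcoh t u) ->
    mcoh ts ts'.

Inductive coh : expr -> expr -> Prop :=
| coh_term t t' : tcoh t t' -> coh (Term t) (Term t')
| coh_mono ts ts' : mcoh ts ts' -> coh (Mono ts) (Mono ts').

(** ** Multilinear partial derivative

    A finite sum with coefficients in [nat] is the list of its summands, each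
    repeated as many times as its coefficient; the zero sum is [[]]. *)

Definition lift2 {A B C : Type} (f : A -> B -> C)
  (S : list A) (T : list B) : list C :=
  flat_map (fun s => map (f s) T) S.

(** All the ways of adding [x] to exactly one block of [P]. *)
Fixpoint add_to_block {A : Type} (x : A) (P : list (list A)) :
    list (list (list A)) :=
  match P with
  | [] => []
  | p :: P' => ((x :: p) :: P') :: map (cons p) (add_to_block x P')
  end.

(** [splits k [u_1; ...; u_n]] lists the [k]-tuples of blocks
    [u_{I_1}, ..., u_{I_k}], one for each tuple [(I_1, ..., I_k)] of pairwise
    disjoint, possibly empty subsets covering [{1, ..., n}]: there are [k ^ n]
    of them, counted with repetitions. *)
Fixpoint splits {A : Type} (k : nat) (us : list A) : list (list (list A)) :=
  match us with
  | [] => [repeat [] k]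
  | u :: us' => flat_map (add_to_block u) (splits k us')
  end.

Fixpoint lift (c : nat) (t : term) : term :=
  match t with
  | Var i => Var (if i <? c then i else S i)
  | Lam s => Lam (lift (S c) s)
  | App s ts => App (lift c s) (map (lift c) ts)
  | ChL s => ChL (lift c s)
  | ChR s => ChR (lift c s)
  end.

(** [deriv x t us] is the derivative of [t] along [us] at the variable [x].
    It is only used to contract a redex, after which the binder of [x]
    disappears: [us] lives in the context without [x], and the variables of [t]
    above [x] are decremented. *)
Fixpoint deriv (x : nat) (t : term) (us : list term) {struct t} : list term :=
  match t with
  | Var y =>
      if y =? x then match us with [u] => [u] | _ => [] end
      else match us with
           | [] => [Var (if y <? x then y else pred y)]
           | _ => []
           end
  | Lam s => map Lam (deriv (S x) s (map (lift 0) us))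
  | App s ts =>
      let derivs := fix derivs (ts : list term) (P : list (list term))
          {struct ts} : list (list term) :=
        match ts, P with
        | [], [] => [[]]
        | t :: ts', p :: P' => lift2 cons (deriv x t p) (derivs ts' P')
        | _, _ => []
        end in
      flat_map (fun Q => match Q with
        | [u1; u2] =>
            lift2 App (deriv x s u1)
              (flat_map (derivs ts) (splits (length ts) u2))
        | _ => []
        end) (splits 2 us)
  | ChL s => map ChL (deriv x s us)
  | ChR s => map ChR (deriv x s us)
  end.

(** ** Reduction

    A step acts on representatives; from another representative of the same
    expression one reaches the same sums, up to equality of their summands. *)

Inductive tred : term -> list term -> Prop :=
| tred_beta s ts : tred (App (Lam s) ts) (deriv 0 s ts)
| tred_app_chl s ts : tred (App (ChL s) ts) [ChL (App s ts)]
| tred_app_chr s ts : tred (App (ChR s) ts) [ChR (App s ts)]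
| tred_lam_chl s : tred (Lam (ChL s)) [ChL (Lam s)]
| tred_lam_chr s : tred (Lam (ChR s)) [ChR (Lam s)]
| tred_lam s S : tred s S -> tred (Lam s) (map Lam S)
| tred_fun s ts S : tred s S -> tred (App s ts) (map (fun s' => App s' ts) S)
| tred_arg s ts T : mred ts T -> tred (App s ts) (map (App s) T)
| tred_chl s S : tred s S -> tred (ChL s) (map ChL S)
| tred_chr s S : tred s S -> tred (ChR s) (map ChR S)
with mred : list term -> list (list term) -> Prop :=
| mred_head t ts S : tred t S -> mred (t :: ts) (map (fun t' => t' :: ts) S)
| mred_tail t ts T : mred ts T -> mred (t :: ts) (map (cons t) T).

Inductive red : expr -> list expr -> Prop :=
| red_term t S : tred t S -> red (Term t) (map Term S)
| red_mono ts T : mred ts T -> red (Mono ts) (map Mono T).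

Inductive sred : list expr -> list expr -> Prop :=
| sred_intro E1 e E2 E' : red e E' -> sred (E1 ++ e :: E2) (E1 ++ E' ++ E2).

Definition sreds : list expr -> list expr -> Prop := clos_refl_trans _ sred.

Definition normal (E : list expr) : Prop := forall E', ~ sred E E'.

(** ** Existence of normal forms

    The measure of a term is lexicographic: [size] decreases at beta steps and
    is kept by the steps that move choices outwards, which decrease [weight]. *)

Fixpoint size (t : term) : nat :=
  match t with
  | Var _ => 1
  | Lam s => 1 + size s
  | App s ts => 1 + size s + list_sum (map size ts)
  | ChL s | ChR s => 1 + size s
  end.

Fixpoint weight (t : term) : nat :=
  match t with
  | Var _ => 1
  | Lam s => 2 * weight s
  | App s ts => 2 * weight s + list_sum (map weight ts)
  | ChL s | ChR s => 1 + weight s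
  end.

Notation sizes ts := (list_sum (map size ts)).
Notation weights ts := (list_sum (map weight ts)).

Lemma size_lift t : forall c, size (lift c t) = size t.
Proof.
  induction t as [i|s IH|s ts IH IHs|s IH|s IH] using term_nested_ind;
    intros c; simpl; auto.
  rewrite IH. enough (sizes (map (lift c) ts) = sizes ts) by lia.
  clear s IH. induction IHs as [|t ts Ht _ IHts]; simpl; auto.
Qed.

Lemma sizes_lift c ts : sizes (map (lift c) ts) = sizes ts.
Proof. induction ts; simpl; auto. now rewrite size_lift, IHts. Qed.

Lemma sizes_repeat_nil k :
  list_sum (map (fun p => sizes p) (repeat (@nil term) k)) = 0.
Proof. induction k; simpl; auto. Qed.

Lemma sizes_add_to_block u : forall P Q, In Q (add_to_block u P) ->
  list_sum (map (fun p => sizes p) Q) =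
  size u + list_sum (map (fun p => sizes p) P).
Proof.
  induction P as [|p P IH]; simpl; intros Q HQ; [easy|].
  destruct HQ as [<-|HQ]; simpl; [lia|].
  apply in_map_iff in HQ as (Q' & <- & HQ'). simpl. rewrite (IH _ HQ'). lia.
Qed.

Lemma sizes_splits k us : forall Q, In Q (splits k us) ->
  list_sum (map (fun p => sizes p) Q) = sizes us.
Proof.
  induction us as [|u us IH]; simpl; intros Q HQ.
  - destruct HQ as [<-|[]]. apply sizes_repeat_nil.
  - apply in_flat_map in HQ as (P & HP & HQ).
    now rewrite (sizes_add_to_block _ _ _ HQ), (IH _ HP).
Qed.

Lemma in_lift2 {A B C} (f : A -> B -> C) S T c :
  In c (lift2 f S T) -> exists a b, c = f a b /\ In a S /\ In b T.
Proof.
  intros H. apply in_flat_map in H as (a & Ha & H).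
  apply in_map_iff in H as (b & <- & Hb). eauto.
Qed.

Lemma size_deriv t : forall x us r, In r (deriv x t us) ->
  size r <= size t + sizes us.
Proof.
  induction t as [i|s IH|s ts IH IHs|s IH|s IH] using term_nested_ind;
    intros x us r Hr; cbn [deriv] in Hr.
  - destruct (i =? x).
    + destruct us as [|u [|]]; simpl in *; try easy.
      destruct Hr as [<-|[]]. lia.
    + destruct us; simpl in *; try easy. destruct Hr as [<-|[]]. simpl. lia.
  - apply in_map_iff in Hr as (r' & <- & Hr). apply IH in Hr.
    rewrite sizes_lift in Hr. simpl. lia.
  - apply in_flat_map in Hr as (Q & HQ & Hr). apply sizes_splits in HQ.
    destruct Q as [|u1 [|u2 [|]]]; try easy. simpl in HQ.
    apply in_lift2 in Hr as (s' & rs & -> & Hs & Hrs). apply IH in Hs.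
    apply in_flat_map in Hrs as (P & HP & Hrs). apply sizes_splits in HP.
    enough (sizes rs <= sizes ts + list_sum (map (fun p => sizes p) P))
      by (simpl; lia).
    clear - IHs Hrs. revert P rs Hrs.
    induction IHs as [|t ts Ht _ IHts]; intros [|p P] rs Hrs; try easy.
    + destruct Hrs as [<-|[]]. simpl. lia.
    + apply in_lift2 in Hrs as (t' & rs' & -> & Ht' & Hrs').
      apply Ht in Ht'. apply IHts in Hrs'. simpl. lia.
  - apply in_map_iff in Hr as (r' & <- & Hr). apply IH in Hr. simpl. lia.
  - apply in_map_iff in Hr as (r' & <- & Hr). apply IH in Hr. simpl. lia.
Qed.

Definition lex (a b a' b' : nat) : Prop := a < a' \/ a = a' /\ b < b'.

Scheme tred_mut := Minimality for tred Sort Prop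
  with mred_mut := Minimality for mred Sort Prop.
Combined Scheme tred_mred_ind from tred_mut, mred_mut.

Lemma red_decreases :
  (forall t S, tred t S -> forall t', In t' S ->
     lex (size t') (weight t') (size t) (weight t)) /\
  (forall ts T, mred ts T -> forall ts', In ts' T ->
     lex (sizes ts') (weights ts') (sizes ts) (weights ts)).
Proof.
  apply tred_mred_ind; unfold lex.
  1: { intros s ts t' H. apply size_deriv in H. simpl. lia. }
  1-4: intros; simpl in *; destruct H as [<-|[]]; simpl; lia.
  all: intros;
    match goal with H : In _ (map _ _) |- _ =>
      apply in_map_iff in H as (? & <- & ?) end;
    match goal with IH : forall _, In _ _ -> _, H : In _ _ |- _ =>
      apply IH in H end; simpl; lia.
Qed.

Fixpoint tred_dec (t : term) : {S | tred t S} + {forall S, ~ tred t S}.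
Proof.
  destruct t as [i|s|s ts|s|s].
  - right. intros S H. inversion H.
  - destruct (tred_dec s) as [[S HS]|N];
      [left; eexists; apply tred_lam; eassumption|].
    destruct s;
      try (left; eexists; apply tred_lam_chl);
      try (left; eexists; apply tred_lam_chr);
      right; intros S H; inversion H; subst; eapply N; eassumption.
  - destruct (tred_dec s) as [[S HS]|N];
      [left; eexists; apply tred_fun; eassumption|].
    assert (Hts : {T | mred ts T} + {forall T, ~ mred ts T}).
    { clear s N. revert ts. fix IH 1. intros [|t ts].
      - right. intros T H. inversion H.
      - destruct (tred_dec t) as [[S HS]|N];
          [left; eexists; apply mred_head; eassumption|].
        destruct (IH ts) as [[T HT]|N'];
          [left; eexists; apply mred_tail; eassumption|].
        right. intros T H.
        inversion H; subst; [eapply N|eapply N']; eassumption. }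
    destruct Hts as [[T HT]|N']; [left; eexists; apply tred_arg; eassumption|].
    destruct s;
      try (left; eexists; apply tred_beta);
      try (left; eexists; apply tred_app_chl);
      try (left; eexists; apply tred_app_chr);
      right; intros S H; inversion H; subst;
      ((eapply N; eassumption) || (eapply N'; eassumption)).
  - destruct (tred_dec s) as [[S HS]|N];
      [left; eexists; apply tred_chl; eassumption|].
    right. intros S H. inversion H; subst. eapply N; eassumption.
  - destruct (tred_dec s) as [[S HS]|N];
      [left; eexists; apply tred_chr; eassumption|].
    right. intros S H. inversion H; subst. eapply N; eassumption.
Qed.

Lemma mred_dec ts : {T | mred ts T} + {forall T, ~ mred ts T}.
Proof.
  induction ts as [|t ts IH].
  - right. intros T H. inversion H.
  - destruct (tred_dec t) as [[S HS]|N];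
      [left; eexists; apply mred_head; eassumption|].
    destruct IH as [[T HT]|N']; [left; eexists; apply mred_tail; eassumption|].
    right. intros T H.
    inversion H; subst; [eapply N|eapply N']; eassumption.
Qed.

Lemma red_dec e : {E | red e E} + {forall E, ~ red e E}.
Proof.
  destruct e as [t|ts].
  - destruct (tred_dec t) as [[S HS]|N];
      [left; eexists; constructor; eassumption|].
    right. intros E H. inversion H; subst. eapply N; eassumption.
  - destruct (mred_dec ts) as [[T HT]|N];
      [left; eexists; constructor; eassumption|].
    right. intros E H. inversion H; subst. eapply N; eassumption.
Qed.

Definition esize (e : expr) : nat :=
  match e with Term t => size t | Mono ts => sizes ts end.

Definition eweight (e : expr) : nat :=
  match e with Term t => weight t | Mono ts => weights ts end.

Definition elt (e' e : expr) : Prop :=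
  lex (esize e') (eweight e') (esize e) (eweight e).

Lemma elt_wf : well_founded elt.
Proof.
  enough (H : forall a b e, esize e = a -> eweight e = b -> Acc elt e)
    by (intros e; eapply H; reflexivity).
  induction a as [a IHa] using lt_wf_ind.
  induction b as [b IHb] using lt_wf_ind.
  intros e Ha Hb. constructor. intros e' [H|[Ea H]].
  - eapply IHa; [|reflexivity|reflexivity]. lia.
  - eapply IHb; [|lia|reflexivity]. lia.
Qed.

Lemma red_elt e E : red e E -> forall e', In e' E -> elt e' e.
Proof.
  intros [t S H|ts T H] e' He'; apply in_map_iff in He' as (x & <- & Hx).
  - exact (proj1 red_decreases _ _ H _ Hx).
  - exact (proj2 red_decreases _ _ H _ Hx).
Qed.

Lemma sreds_context E1 E2 E E' :
  sreds E E' -> sreds (E1 ++ E ++ E2) (E1 ++ E' ++ E2).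
Proof.
  intros H. induction H as [E E' [F1 e F2 F H]|E|E E' E'' _ IH1 _ IH2].
  - apply rt_step. rewrite <- !app_assoc, !(app_assoc E1).
    now apply (sred_intro _ e).
  - apply rt_refl.
  - eapply rt_trans; eassumption.
Qed.

Lemma sreds_app E E' F F' :
  sreds E E' -> sreds F F' -> sreds (E ++ F) (E' ++ F').
Proof.
  intros HE HF. apply rt_trans with (E' ++ F).
  - exact (sreds_context [] F _ _ HE).
  - apply (sreds_context E' []) in HF. now rewrite !app_nil_r in HF.
Qed.

Lemma normal_iff E : normal E <-> forall e E', In e E -> ~ red e E'.
Proof.
  split.
  - intros N e E' He H. apply in_split in He as (E1 & E2 & ->).
    eapply N. constructor. exact H.
  - intros N E' H. destruct H as [E1 e E2 E' H]. eapply N; [|exact H].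
    apply in_or_app. simpl. auto.
Qed.

Lemma normalizes_all E :
  (forall e, In e E -> {N | sreds [e] N /\ normal N}) ->
  {N | sreds E N /\ normal N}.
Proof.
  induction E as [|e E IH]; intros H.
  - exists []. split; [apply rt_refl|]. now apply normal_iff.
  - destruct (H e) as (N & HN & NN); [now left|].
    destruct IH as (N' & HN' & NN'); [intros; apply H; now right|].
    exists (N ++ N'). split; [exact (sreds_app [e] _ _ _ HN HN')|].
    rewrite normal_iff in *. intros f E' Hf.
    apply in_app_or in Hf as [Hf|Hf]; auto.
Qed.

Theorem normalizes (E : list expr) : {N | sreds E N /\ normal N}.
Proof.
  apply normalizes_all. intros e _.
  induction e as [e IH] using (well_founded_induction_type elt_wf).
  destruct (red_dec e) as [[E' H]|N].
  - destruct (normalizes_all E') as (N & HN & NN).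
    { intros e' He'. apply IH. exact (red_elt _ _ H _ He'). }
    exists N. split; [|exact NN]. eapply rt_trans; [|exact HN]. apply rt_step.
    pose proof (sred_intro [] e [] E' H) as Hs. simpl in Hs.
    now rewrite app_nil_r in Hs.
  - exists [e]. split; [apply rt_refl|]. apply normal_iff.
    intros f E' [<-|[]]. apply N.
Qed.

(** ** Normal form and support

    By confluence, the normal form is unique up to the order of the sum and the
    choice of representatives. *)

Definition NF (E : list expr) : list expr := proj1_sig (normalizes E).

Lemma NF_spec E : sreds E (NF E) /\ normal (NF E).
Proof. exact (proj2_sig (normalizes E)). Qed.

Definition supp (E : list expr) (e : expr) : Prop :=
  exists e', In e' E /\ eeq e' e.

(* Main.v *)
Require Import Defs.
From Stdlib Require Import Arith List Lia Relations Permutation Wellfounded.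
From Stdlib Require Import SetoidList SetoidPermutation.
Import ListNotations.

(** Any two reductions of a term are locally confluent, so by Newman's lemma a
    normal summand reachable from [t] stays reachable whichever redex of [t] is
    contracted.  This allows reducing two coherent terms along their spines
    simultaneously.  A head step keeps every summand of one side coherent with
    every summand of the other, and is injective on coherent pairs: the multiset
    of substituted terms is read back from the result, because coherent terms
    have the same variable occurrences except below opposite choices, which
    never yield a common result.  When the spines are normal, a common normal
    form decomposes into common normal forms of the coherent immediate
    subterms; well-founded induction on the termination measure concludes. *)

(** [NF [e]] is some normal sum reached from [e]; the reduction leading to it need not follow the
    spine of [e], nor match the one chosen for [e']. This is why the invariance of reachable normal
    summands is wanted: it reroutes both given reductions through a pair of steps for which
    coherence can be followed.

    Steps produce sums, so a one-sided form of local confluence is used: a summand of one reduct may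
    be reduced further, in all its branches, until everything left is reachable from the other
    reduct. Such diagrams close because substitution is linear: each argument lands at exactly one
    occurrence, so a step of an argument is one step of every summand, never several and never none.
    The beta case against a substitution is the chain rule for derivatives.

    Permutations of bags are kept apart from equality of terms: reduction and substitution only use
    [Permutation] on literal lists, and [teq] enters when two results are compared. *)

Ltac perm_atoms :=
  simpl; rewrite <- ?app_assoc, ?app_nil_r;
  solve [reflexivity
  | repeat first
    [ reflexivity
    | apply Permutation_app_head
    | match goal with
      | |- Permutation (?a ++ _) (?b ++ ?m) =>
          rewrite (Permutation_app_comm b m), <- ?app_assoc
      | |- Permutation ?a (?b ++ ?m) =>
          rewrite (Permutation_app_comm b m), <- ?app_assoc
      end ] ].

(** Blocks named by a permutation hypothesis are expanded; then the right-hand side is rotated until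
    its first block can be cancelled. *)
Ltac perm :=
  repeat match goal with
  | H : Permutation ?u _ |- context [?u] => is_var u; rewrite H; clear H
  end; perm_atoms.

Lemma permutation_cons_app {A} (t : A) us u1 u2 :
  Permutation (t :: us) (u1 ++ u2) ->
  (exists v, Permutation u1 (t :: v) /\ Permutation us (v ++ u2)) \/
  (exists v, Permutation u2 (t :: v) /\ Permutation us (u1 ++ v)).
Proof.
  intros H.
  assert (Hi : In t (u1 ++ u2)) by (rewrite <- H; now left).
  apply in_app_or in Hi as [Hi|Hi]; apply in_split in Hi as (a & b & ->).
  - left. exists (a ++ b). split.
    + symmetry. apply Permutation_middle.
    + apply Permutation_cons_inv with t. rewrite H.
      rewrite <- !app_assoc. symmetry. apply Permutation_middle.
  - right. exists (a ++ b). split.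
    + symmetry. apply Permutation_middle.
    + apply Permutation_cons_inv with t. rewrite H, !app_assoc.
      symmetry. apply Permutation_middle.
Qed.

Lemma permutation_map_app_inv {A B} (f : A -> B) us v1 v2 :
  Permutation (map f us) (v1 ++ v2) ->
  exists u1 u2, v1 = map f u1 /\ v2 = map f u2 /\ Permutation us (u1 ++ u2).
Proof.
  intros H. symmetry in H. apply Permutation_map_inv in H as (l & E & H).
  symmetry in E. apply map_eq_app in E as (u1 & u2 & -> & <- & <-).
  eauto.
Qed.

(** * Linear substitution as a relation *)

Section TermTermsInd.
Context (P : term -> Prop) (Q : list term -> Prop).

(* The function of an application is treated as the head of its bag. *)
Lemma term_terms_ind :
  (forall i, P (Var i)) -> (forall s, P s -> P (Lam s)) ->
  (forall s ts, Q (s :: ts) -> P (App s ts)) ->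
  (forall s, P s -> P (ChL s)) -> (forall s, P s -> P (ChR s)) ->
  Q [] -> (forall t ts, P t -> Q ts -> Q (t :: ts)) ->
  (forall t, P t) /\ (forall ts, Q ts).
Proof.
  intros HV HL HA Hl Hr Hn Hc.
  assert (HP : forall t, P t).
  { intros t. induction t as [i|s IH|s ts IH IHs|s IH|s IH] using term_nested_ind;
      auto.
    apply HA, Hc; [exact IH|]. induction IHs; auto. }
  split; [exact HP|]. intros ts. induction ts; auto.
Qed.
End TermTermsInd.

(** The summands of [deriv], in a form suited to inversion. Bags are cut up to [Permutation] instead
    of by enumerated index sets, and an application is a single cut with the function as first
    element, in place of the two nested cuts of [deriv]. *)
Inductive dsub : nat -> term -> list term -> term -> Prop :=
| dsub_here x u : dsub x (Var x) [u] u
| dsub_other x y :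
    y <> x -> dsub x (Var y) [] (Var (if y <? x then y else pred y))
| dsub_lam x s us r :
    dsub (S x) s (map (lift 0) us) r -> dsub x (Lam s) us (Lam r)
| dsub_app x s ts us r rs :
    dsubs x (s :: ts) us (r :: rs) -> dsub x (App s ts) us (App r rs)
| dsub_chl x s us r : dsub x s us r -> dsub x (ChL s) us (ChL r)
| dsub_chr x s us r : dsub x s us r -> dsub x (ChR s) us (ChR r)
with dsubs : nat -> list term -> list term -> list term -> Prop :=
| dsubs_nil x : dsubs x [] [] []
| dsubs_cons x t ts us u1 u2 r rs :
    Permutation us (u1 ++ u2) -> dsub x t u1 r -> dsubs x ts u2 rs ->
    dsubs x (t :: ts) us (r :: rs).

Lemma dsub_perm_mut :
  (forall t x us r vs, dsub x t us r -> Permutation us vs -> dsub x t vs r) /\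
  (forall ts x us rs vs,
     dsubs x ts us rs -> Permutation us vs -> dsubs x ts vs rs).
Proof.
  apply term_terms_ind.
  - intros i x us r vs H E. inversion H; subst.
    + apply Permutation_length_1_inv in E as ->. constructor.
    + apply Permutation_nil in E as ->. now constructor.
  - intros s IH x us r vs H E. inversion H; subst. constructor.
    eapply IH; [eassumption|]. now apply Permutation_map.
  - intros s ts IH x us r vs H E. inversion H; subst. constructor. eauto.
  - intros s IH x us r vs H E. inversion H; subst. constructor. eauto.
  - intros s IH x us r vs H E. inversion H; subst. constructor. eauto.
  - intros x us rs vs H E. inversion H; subst.
    apply Permutation_nil in E as ->. constructor.
  - intros t ts _ _ x us rs vs H E. inversion H; subst.
    econstructor; [|eassumption..]. now rewrite <- E.
Qed.

Lemma dsub_perm x t us vs r :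
  Permutation us vs -> dsub x t us r -> dsub x t vs r.
Proof. intros E H. eapply dsub_perm_mut; eassumption. Qed.

Lemma dsubs_perm x ts us vs rs :
  Permutation us vs -> dsubs x ts us rs -> dsubs x ts vs rs.
Proof. intros E H. eapply dsub_perm_mut; eassumption. Qed.

(** * Enumerated splittings and agreement with [deriv] *)

Lemma in_add_to_block {A} (u : A) P Q :
  In Q (add_to_block u P) <->
  exists P1 p P2, P = P1 ++ p :: P2 /\ Q = P1 ++ (u :: p) :: P2.
Proof.
  revert Q. induction P as [|p P IH]; simpl; intros Q.
  - split; [easy|]. intros ([|] & ? & ? & ? & _); discriminate.
  - split.
    + intros [<-|H]; [exists [], p, P; auto|].
      apply in_map_iff in H as (Q' & <- & H).
      apply IH in H as (P1 & p' & P2 & -> & ->). exists (p :: P1), p', P2. auto.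
    + intros ([|p1 P1] & p' & P2 & E & ->); injection E as -> ->; [now left|].
      right. apply (in_map (cons p1)), IH. eauto.
Qed.

Lemma splits_sound {A} k (us : list A) : forall P, In P (splits k us) ->
  length P = k /\ Permutation us (concat P).
Proof.
  induction us as [|u us IH]; simpl; intros P H.
  - destruct H as [<-|[]]. split; [apply repeat_length|].
    replace (concat (repeat [] k)) with (@nil A); [reflexivity|].
    induction k; simpl; auto.
  - apply in_flat_map in H as (P' & HP & H).
    apply in_add_to_block in H as (P1 & p & P2 & -> & ->).
    apply IH in HP as [HL HP]. rewrite length_app in *. split; [exact HL|].
    rewrite concat_app in *. simpl in *. rewrite HP. apply Permutation_middle.
Qed.

(** Blocks can be matched only up to order: [splits] keeps the elements of a block in the order of
    [us], whereas [Q] lists them in any order. *)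
Lemma splits_complete {A} k (us : list A) : forall Q,
  length Q = k -> Permutation us (concat Q) ->
  exists P, In P (splits k us) /\ Forall2 (@Permutation A) P Q.
Proof.
  induction us as [|u us IH]; simpl; intros Q HL HQ.
  - exists (repeat [] k). split; [now left|]. subst k.
    apply Permutation_nil in HQ.
    induction Q as [|q Q IHQ]; simpl in *; constructor.
    + apply app_eq_nil in HQ as [-> _]. constructor.
    + apply IHQ. now apply app_eq_nil in HQ.
  - assert (Hi : In u (concat Q)) by (rewrite <- HQ; now left).
    apply in_concat in Hi as (q & Hq & Hu).
    apply in_split in Hq as (Q1 & Q2 & ->).
    apply in_split in Hu as (q1 & q2 & ->).
    (* [u] is taken out of its block, and put back at the head of the corresponding block of the
       recursive splitting. *)
    destruct (IH (Q1 ++ (q1 ++ q2) :: Q2)) as (P & HP & HF).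
    { rewrite length_app in *. exact HL. }
    { apply Permutation_cons_inv with u. rewrite HQ, !concat_app. simpl.
      rewrite <- !app_assoc. simpl. rewrite !(app_assoc (concat Q1)).
      symmetry. apply Permutation_middle. }
    apply Forall2_app_inv_r in HF as (P1 & P2' & HF1 & HF2 & ->).
    inversion HF2 as [|p ? P2 ? Hp HF2']; subst.
    exists (P1 ++ (u :: p) :: P2). split.
    + apply in_flat_map. eexists. split; [exact HP|].
      apply in_add_to_block. eauto.
    + apply Forall2_app; [exact HF1|]. constructor; [|exact HF2'].
      rewrite Hp. apply Permutation_middle.
Qed.

(* Convertible to the local fixpoint of [deriv], hence its shape. *)
Definition derivs (x : nat) : list term -> list (list term) -> list (list term) :=
  fix derivs ts P :=
    match ts, P with
    | [], [] => [[]]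
    | t :: ts', p :: P' => lift2 cons (deriv x t p) (derivs ts' P')
    | _, _ => []
    end.

Lemma deriv_app x s ts us :
  deriv x (App s ts) us =
  flat_map (fun Q => match Q with
    | [u1; u2] => lift2 App (deriv x s u1)
        (flat_map (derivs x ts) (splits (length ts) u2))
    | _ => []
    end) (splits 2 us).
Proof. reflexivity. Qed.

Lemma in_lift2_iff {A B C} (f : A -> B -> C) S T c :
  In c (lift2 f S T) <-> exists a b, c = f a b /\ In a S /\ In b T.
Proof.
  split; [apply in_lift2|]. intros (a & b & -> & Ha & Hb).
  apply in_flat_map. exists a. split; [exact Ha|]. now apply in_map.
Qed.

(** The completeness half for lists ranges over all blockwise permutations [P] of one witness [Q],
    because [splits] decides the order inside the blocks. *)
Lemma in_deriv_mut :
  (forall t x us r, In r (deriv x t us) <-> dsub x t us r) /\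
  (forall ts,
    (forall x P rs, In rs (derivs x ts P) -> dsubs x ts (concat P) rs) /\
    (forall x us rs, dsubs x ts us rs -> exists Q, length Q = length ts /\
       Permutation us (concat Q) /\
       forall P, Forall2 (@Permutation term) P Q -> In rs (derivs x ts P))).
Proof.
  apply term_terms_ind.
  - intros i x us r. simpl. destruct (Nat.eqb_spec i x) as [->|N]; split.
    + destruct us as [|u [|]]; simpl; try easy. intros [->|[]]. constructor.
    + intros H. inversion H; subst; [now left|easy].
    + destruct us; simpl; try easy. intros [<-|[]]. now constructor.
    + intros H. inversion H; subst; [easy|now left].
  - intros s IH x us r. simpl. rewrite in_map_iff. split.
    + intros (r' & <- & H). constructor. now apply IH.
    + intros H. inversion H; subst. eexists. split; [reflexivity|]. now apply IH.
  - intros s ts [IH1 IH2] x us r. rewrite deriv_app, in_flat_map. split.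
    + intros (Q & HQ & H). destruct Q as [|u1 [|u2 [|]]]; try easy.
      apply in_lift2 in H as (r0 & rs & -> & H0 & H).
      apply in_flat_map in H as (P & HP & H).
      apply splits_sound in HQ as [_ HQ]. apply splits_sound in HP as [_ HP].
      constructor. apply dsubs_perm with (concat (u1 :: P)).
      { simpl in *. rewrite HQ, HP, app_nil_r. reflexivity. }
      apply IH1. simpl. apply in_lift2_iff. eauto 6.
    + intros H. inversion H as [| | |? ? ? ? r0 rs H'| |]; subst.
      apply IH2 in H' as ([|q Q] & HL & HQ & H'); [discriminate|].
      injection HL as HL.
      (* The single cut [q :: Q] becomes two nested ones: the share of the function against all the
         rest, then a cut of [v2], the order in which the first enumeration returns that rest. *)
      destruct (splits_complete 2 us [q; concat Q]) as (P2 & HP2 & HF);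
        [reflexivity|simpl in *; now rewrite app_nil_r|].
      inversion HF as [|v1 ? ? ? E1 HF']; subst.
      inversion HF' as [|v2 ? ? ? E2 HF'']; subst. inversion HF''; subst.
      destruct (splits_complete (length ts) v2 Q HL E2) as (P & HP & HPQ).
      specialize (H' (v1 :: P) (Forall2_cons _ _ E1 HPQ)).
      simpl in H'. apply in_lift2 in H' as (a & b & E & Ha & Hb).
      injection E as <- <-.
      exists [v1; v2]. split; [exact HP2|]. apply in_lift2_iff.
      exists r0, rs. split; [reflexivity|]. split; [exact Ha|].
      apply in_flat_map. eauto.
  - intros s IH x us r. simpl. rewrite in_map_iff. split.
    + intros (r' & <- & H). constructor. now apply IH.
    + intros H. inversion H; subst. eexists. split; [reflexivity|]. now apply IH.
  - intros s IH x us r. simpl. rewrite in_map_iff. split.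
    + intros (r' & <- & H). constructor. now apply IH.
    + intros H. inversion H; subst. eexists. split; [reflexivity|]. now apply IH.
  - split.
    + intros x [|] rs; simpl; [|easy]. intros [<-|[]]. constructor.
    + intros x us rs H. inversion H; subst. exists []. repeat split; auto.
      intros P HP. inversion HP; subst. now left.
  - intros t ts IHt [IH1 IH2]. split.
    + intros x [|p P] rs; simpl; [easy|]. intros H.
      apply in_lift2 in H as (r & rs' & -> & Hr & Hrs).
      econstructor; [reflexivity|now apply IHt|now apply IH1].
    + intros x us rs H.
      inversion H as [|? ? ? ? u1 u2 r rs' E Hr Hrs]; subst.
      apply IH2 in Hrs as (Q & HL & HQ & Hrs). exists (u1 :: Q).
      simpl. split; [now rewrite HL|]. split; [now rewrite E, HQ|].
      intros P HP. inversion HP as [|p ? P' ? Hp HP']; subst. simpl.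
      apply in_lift2_iff. exists r, rs'. split; [reflexivity|].
      split; [|now apply Hrs]. apply IHt.
      eapply dsub_perm; [symmetry; exact Hp|exact Hr].
Qed.

Lemma in_deriv x t us r : In r (deriv x t us) <-> dsub x t us r.
Proof. apply in_deriv_mut. Qed.

(** * Lifting and linear substitution *)

Ltac case_ltb :=
  repeat match goal with
  | |- context [?a <? ?b] => destruct (Nat.ltb_spec a b)
  | H : context [?a <? ?b] |- _ => destruct (Nat.ltb_spec a b)
  end.

Lemma lift_lift t : forall c d, c <= d ->
  lift (S d) (lift c t) = lift c (lift d t).
Proof.
  induction t as [i|s IH|s ts IH IHs|s IH|s IH] using term_nested_ind;
    intros c d L; simpl.
  - f_equal. case_ltb; lia.
  - f_equal. apply IH. lia.
  - f_equal; [now apply IH|]. rewrite !map_map. apply map_ext_Forall.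
    eapply Forall_impl; [|exact IHs]. simpl. auto.
  - f_equal. now apply IH.
  - f_equal. now apply IH.
Qed.

Lemma map_lift_lift c us :
  map (lift (S c)) (map (lift 0) us) = map (lift 0) (map (lift c) us).
Proof.
  rewrite !map_map. apply map_ext. intros. apply lift_lift. lia.
Qed.

(* Lifting at [c] turns [x] into [x'] and, since the binder of [x] disappears in
   the result, must be done at [c'] in the term substituted into. *)
Definition lift_index (c x x' c' : nat) : Prop :=
  (x' = S x /\ c' = c /\ c <= x) \/ (x' = x /\ c' = S c /\ x <= c).

Lemma lift_index_S c x x' c' :
  lift_index c x x' c' -> lift_index (S c) (S x) (S x') (S c').
Proof. unfold lift_index. lia. Qed.

(** Right to left, a substitution is carried under a binder. Left to right, substituting lifted
    arguments in a lifted term creates only lifted results, which is what allows a binder to be left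
    again. *)
Lemma dsub_lift_mut :
  (forall t c x x' c' us r', lift_index c x x' c' ->
     dsub x' (lift c' t) (map (lift c) us) r' <->
     exists r, r' = lift c r /\ dsub x t us r) /\
  (forall ts c x x' c' us rs', lift_index c x x' c' ->
     dsubs x' (map (lift c') ts) (map (lift c) us) rs' <->
     exists rs, rs' = map (lift c) rs /\ dsubs x ts us rs).
Proof.
  apply term_terms_ind.
  - intros i c x x' c' us r' L. simpl. unfold lift_index in L. split.
    + intros H. inversion H as [y u E1 E2 E3|y z N E1 E2 E3| | | |]; subst.
      * destruct us as [|v [|]]; try discriminate.
        injection E3 as E3; subst. exists v. split; [reflexivity|].
        replace i with x by (case_ltb; lia). constructor.
      * destruct us; [|discriminate].
        assert (N' : i <> x) by (case_ltb; lia).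
        eexists. split; [|apply dsub_other; exact N'].
        simpl. f_equal. case_ltb; lia.
    + intros (r & -> & H). inversion H as [|y z N| | | |]; subst; simpl.
      * replace (if i <? c' then i else S i) with x' by (case_ltb; lia).
        constructor.
      * match goal with |- dsub _ (Var ?j) _ (Var ?k) => replace k with
          (if j <? x' then j else pred j) by (case_ltb; lia) end.
        constructor. case_ltb; lia.
  - intros s IH c x x' c' us r' L. simpl.
    pose proof (IH (S c) (S x) (S x') (S c') (map (lift 0) us)) as IH'.
    rewrite map_lift_lift in IH'. split.
    + intros H. inversion H as [| |? ? ? r0 H0| | |]; subst.
      apply IH' in H0 as (r & -> & Hr); [|now apply lift_index_S].
      exists (Lam r). split; [reflexivity|]. now constructor.
    + intros (r & -> & H). inversion H; subst. simpl. constructor.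
      apply IH'; [now apply lift_index_S|]. eauto.
  - intros s ts IH c x x' c' us r' L. simpl.
    change (lift c' s :: map (lift c') ts) with (map (lift c') (s :: ts)). split.
    + intros H. inversion H as [| | |? ? ? ? r0 rs0 H0| |]; subst.
      apply (IH _ _ _ _ _ (r0 :: rs0) L) in H0 as ([|r rs] & E & Hr);
        [discriminate|].
      injection E as -> ->.
      exists (App r rs). split; [reflexivity|]. now constructor.
    + intros (r & -> & H). inversion H as [| | |? ? ? ? r0 rs0 H0| |]; subst.
      simpl. constructor. apply (IH _ _ _ _ _ (lift c r0 :: map (lift c) rs0) L).
      now exists (r0 :: rs0).
  - intros s IH c x x' c' us r' L. simpl. split.
    + intros H. inversion H as [| | | |? ? ? r0 H0|]; subst.
      apply (IH _ _ _ _ _ _ L) in H0 as (r & -> & Hr).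
      exists (ChL r). split; [reflexivity|]. now constructor.
    + intros (r & -> & H). inversion H; subst. simpl. constructor.
      apply (IH _ _ _ _ _ _ L). eauto.
  - intros s IH c x x' c' us r' L. simpl. split.
    + intros H. inversion H as [| | | | |? ? ? r0 H0]; subst.
      apply (IH _ _ _ _ _ _ L) in H0 as (r & -> & Hr).
      exists (ChR r). split; [reflexivity|]. now constructor.
    + intros (r & -> & H). inversion H; subst. simpl. constructor.
      apply (IH _ _ _ _ _ _ L). eauto.
  - intros c x x' c' us rs' L. simpl. split.
    + intros H. inversion H; subst. destruct us; [|discriminate].
      exists []. split; [reflexivity|]. constructor.
    + intros (rs & -> & H). inversion H; subst. constructor.
  - intros t ts IHt IH c x x' c' us rs' L. simpl. split.
    + intros H. inversion H as [|? ? ? ? v1 v2 r0 rs0 E H1 H2]; subst.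
      apply permutation_map_app_inv in E as (u1 & u2 & -> & -> & E).
      apply (IHt _ _ _ _ _ _ L) in H1 as (r & -> & H1).
      apply (IH _ _ _ _ _ _ L) in H2 as (rs & -> & H2).
      exists (r :: rs). split; [reflexivity|]. econstructor; eassumption.
    + intros (rs & -> & H).
      inversion H as [|? ? ? ? u1 u2 r0 rs0 E H1 H2]; subst. simpl.
      apply dsubs_cons with (map (lift c) u1) (map (lift c) u2).
      * rewrite <- map_app. now apply Permutation_map.
      * apply (IHt _ _ _ _ _ _ L). eauto.
      * apply (IH _ _ _ _ _ _ L). eauto.
Qed.

Lemma dsubs_lift_below c x ts us rs' : c <= x ->
  dsubs (S x) (map (lift c) ts) (map (lift c) us) rs' <->
  exists rs, rs' = map (lift c) rs /\ dsubs x ts us rs.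
Proof. intros L. apply dsub_lift_mut. left. auto. Qed.

Lemma dsub_lift_above c x t us r' : x <= c ->
  dsub x (lift (S c) t) (map (lift c) us) r' <->
  exists r, r' = lift c r /\ dsub x t us r.
Proof. intros L. apply dsub_lift_mut. right. auto. Qed.

(** The index [k] does not occur in [lift k t]: no argument can be placed, and the decrement of the
    indices above [k] undoes the lifting. *)
Lemma dsub_lift_cancel_mut :
  (forall t k us r, dsub k (lift k t) us r <-> us = [] /\ r = t) /\
  (forall ts k us rs, dsubs k (map (lift k) ts) us rs <-> us = [] /\ rs = ts).
Proof.
  apply term_terms_ind.
  - intros i k us r. simpl. split.
    + intros H. inversion H; subst; [case_ltb; lia|].
      split; [reflexivity|]. f_equal. case_ltb; lia.
    + intros (-> & ->). replace (Var i) with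
        (let j := if i <? k then i else S i in Var (if j <? k then j else pred j))
        by (simpl; f_equal; case_ltb; lia).
      constructor. case_ltb; lia.
  - intros s IH k us r. simpl. split.
    + intros H. inversion H as [| |? ? ? r0 H0| | |]; subst.
      apply IH in H0 as [E ->]. destruct us; [auto|discriminate].
    + intros (-> & ->). constructor. now apply IH.
  - intros s ts IH k us r. simpl.
    change (lift k s :: map (lift k) ts) with (map (lift k) (s :: ts)). split.
    + intros H. inversion H as [| | |? ? ? ? r0 rs0 H0| |]; subst.
      apply (IH k us (r0 :: rs0)) in H0 as [-> E]. now injection E as -> ->.
    + intros (-> & ->). constructor. now apply (IH k [] (s :: ts)).
  - intros s IH k us r. simpl. split.
    + intros H. inversion H as [| | | |? ? ? r0 H0|]; subst.
      now apply IH in H0 as [-> ->].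
    + intros (-> & ->). constructor. now apply IH.
  - intros s IH k us r. simpl. split.
    + intros H. inversion H as [| | | | |? ? ? r0 H0]; subst.
      now apply IH in H0 as [-> ->].
    + intros (-> & ->). constructor. now apply IH.
  - intros k us rs. simpl. split.
    + intros H. now inversion H.
    + intros (-> & ->). constructor.
  - intros t ts IHt IH k us rs. simpl. split.
    + intros H. inversion H as [|? ? ? ? v1 v2 r0 rs0 E H1 H2]; subst.
      apply IHt in H1 as [-> ->]. apply IH in H2 as [-> ->].
      split; [|reflexivity]. symmetry in E. now apply Permutation_nil in E.
    + intros (-> & ->). apply dsubs_cons with [] [].
      * reflexivity.
      * now apply IHt.
      * now apply IH.
Qed.

Lemma dsub_lift_cancel k t us r : dsub k (lift k t) us r <-> us = [] /\ r = t.
Proof. apply dsub_lift_cancel_mut. Qed.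

(** * Commutation of linear substitutions *)

Lemma dsubs_app x ts1 ts2 u1 u2 r1 r2 :
  dsubs x ts1 u1 r1 -> dsubs x ts2 u2 r2 ->
  dsubs x (ts1 ++ ts2) (u1 ++ u2) (r1 ++ r2).
Proof.
  intros H1 H2. revert u1 r1 H1.
  induction ts1 as [|t ts1 IH]; simpl; intros u1 r1 H1.
  - inversion H1; subst. exact H2.
  - inversion H1 as [|? ? ? ? v1 v2 r0 rs0 E H3 H4]; subst. simpl.
    apply dsubs_cons with v1 (v2 ++ u2); auto. perm.
Qed.

Lemma dsubs_app_result x ts us r1 r2 : dsubs x ts us (r1 ++ r2) ->
  exists ts1 ts2 u1 u2, ts = ts1 ++ ts2 /\ Permutation us (u1 ++ u2) /\
    dsubs x ts1 u1 r1 /\ dsubs x ts2 u2 r2.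
Proof.
  revert ts us. induction r1 as [|r r1 IH]; simpl; intros ts us H.
  - exists [], ts, [], us. repeat split; auto. constructor.
  - inversion H as [|? t ts0 ? v1 v2 r0 rs0 E H1 H2]; subst.
    apply IH in H2 as (ts1 & ts2 & u1 & u2 & -> & E' & Hr1 & Hr2).
    exists (t :: ts1), ts2, (v1 ++ u1), u2. repeat split; auto.
    + perm.
    + now apply dsubs_cons with v1 u1.
Qed.

Lemma dsubs_perm_terms x ts ts' us rs :
  Permutation ts ts' -> dsubs x ts us rs ->
  exists rs', Permutation rs rs' /\ dsubs x ts' us rs'.
Proof.
  intros E. revert us rs.
  induction E as [|t ts ts' E IH|t t' ts|ts ts' ts'' _ IH1 _ IH2];
    intros us rs H.
  - exists rs. auto.
  - inversion H as [|? ? ? ? v1 v2 r0 rs0 E' H1 H2]; subst.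
    apply IH in H2 as (rs' & Er & H2). exists (r0 :: rs').
    split; [now constructor|]. econstructor; eassumption.
  - inversion H as [|? ? ? ? v1 v2 r0 rs0 E' H1 H2]; subst.
    inversion H2 as [|? ? ? ? v3 v4 r1 rs1 E'' H3 H4]; subst.
    exists (r1 :: r0 :: rs1). split; [constructor|].
    apply dsubs_cons with v3 (v1 ++ v4); [perm|assumption|].
    apply dsubs_cons with v1 v4; auto.
  - apply IH1 in H as (r1 & E1 & H). apply IH2 in H as (r2 & E2 & H).
    exists r2. split; [|exact H]. now transitivity r1.
Qed.

Lemma dsubs_perm_results x ts us rs rs' :
  Permutation rs rs' -> dsubs x ts us rs ->
  exists ts', Permutation ts ts' /\ dsubs x ts' us rs'.
Proof.
  intros E. revert us ts.
  induction E as [|r rs rs' E IH|r r' rs|rs rs' rs'' _ IH1 _ IH2];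
    intros us ts H.
  - exists ts. auto.
  - inversion H as [|? t ts0 ? v1 v2 r0 rs0 E' H1 H2]; subst.
    apply IH in H2 as (ts' & Et & H2). exists (t :: ts').
    split; [now constructor|]. econstructor; eassumption.
  - inversion H as [|? t ts0 ? v1 v2 r0 rs0 E' H1 H2]; subst.
    inversion H2 as [|? t' ts1 ? v3 v4 r1 rs1 E'' H3 H4]; subst.
    exists (t' :: t :: ts1). split; [constructor|].
    apply dsubs_cons with v3 (v1 ++ v4); [perm|assumption|].
    apply dsubs_cons with v1 v4; auto.
  - apply IH1 in H as (t1 & E1 & H). apply IH2 in H as (t2 & E2 & H).
    exists t2. split; [|exact H]. now transitivity t1.
Qed.

(* This lemma and the next are the two inclusions of the chain rule
   [d_x (d_y s . ts) . us = sum d_y (d_x s . us1) . (d_x ts . us2)], the sum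
   ranging over the splittings of [us] in two. *)
Lemma dsub_dsub_split_mut :
  (forall s k x ts us s1 r, k <= x -> dsub k s ts s1 -> dsub x s1 us r ->
     exists u1 u2 s' ts', Permutation us (u1 ++ u2) /\
       dsub (S x) s (map (lift k) u1) s' /\ dsubs x ts u2 ts' /\
       dsub k s' ts' r) /\
  (forall ss k x ts us ss1 rs, k <= x -> dsubs k ss ts ss1 -> dsubs x ss1 us rs ->
     exists u1 u2 ss' ts', Permutation us (u1 ++ u2) /\
       dsubs (S x) ss (map (lift k) u1) ss' /\ dsubs x ts u2 ts' /\
       dsubs k ss' ts' rs).
Proof.
  apply term_terms_ind.
  - intros i k x ts us s1 r L H1 H2.
    inversion H1 as [? u|? ? N| | | |]; subst.
    (* The inner substitution hits this variable, so everything comes from the single argument,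
       which receives the whole of [us]. *)
    + exists [], us, (Var i), [r]. repeat split; auto.
      * replace (Var i) with (Var (if i <? S x then i else pred i)) at 2
          by (f_equal; case_ltb; lia).
        constructor. lia.
      * apply dsubs_cons with us []; [perm|assumption|constructor].
      * constructor.
    + inversion H2 as [? u E|? ? N' E| | | |]; subst.
      (* The index that became [x] after the removal of [k] was [S x], since [k <= x]; what replaces
         it is first lifted over [k]. *)
      * assert (i = S (if i <? k then i else pred i)) by (case_ltb; lia).
        exists [r], [], (lift k r), [].
        split; [reflexivity|]. split; [rewrite <- H; constructor|].
        split; [constructor|]. now apply dsub_lift_cancel.
      * exists [], [], (Var (if i <? S x then i else pred i)), [].
        split; [reflexivity|].
        split; [constructor; case_ltb; lia|]. split; [constructor|].
        match goal with |- dsub _ (Var ?j) _ (Var ?k') => replace k' with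
          (if j <? k then j else pred j) by (case_ltb; lia) end.
        constructor. case_ltb; lia.
  - intros s IH k x ts us s1 r L H1 H2. inversion H1; subst.
    inversion H2; subst.
    edestruct (IH (S k) (S x)) as (v1 & v2 & s' & ts' & E & Ha & Hb & Hc);
      [lia|eassumption..|].
    apply permutation_map_app_inv in E as (u1 & u2 & -> & -> & E).
    apply dsubs_lift_below in Hb as (ts0 & -> & Hb); [|lia].
    rewrite map_lift_lift in Ha.
    exists u1, u2, (Lam s'), ts0. repeat split; auto; now constructor.
  - intros s ss IH k x ts us s1 r L H1 H2. inversion H1; subst.
    inversion H2; subst.
    edestruct IH as (u1 & u2 & ss' & ts' & E & Ha & Hb & Hc); [eassumption..|].
    inversion Ha; subst. do 4 eexists. split; [exact E|].
    split; [constructor; exact Ha|]. split; [exact Hb|]. now constructor.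
  - intros s IH k x ts us s1 r L H1 H2. inversion H1; subst.
    inversion H2; subst.
    edestruct IH as (u1 & u2 & s' & ts' & E & Ha & Hb & Hc); [eassumption..|].
    exists u1, u2, (ChL s'), ts'. repeat split; auto; now constructor.
  - intros s IH k x ts us s1 r L H1 H2. inversion H1; subst.
    inversion H2; subst.
    edestruct IH as (u1 & u2 & s' & ts' & E & Ha & Hb & Hc); [eassumption..|].
    exists u1, u2, (ChR s'), ts'. repeat split; auto; now constructor.
  - intros k x ts us ss1 rs L H1 H2. inversion H1; subst. inversion H2; subst.
    exists [], [], [], []. repeat split; constructor.
  - intros s ss IHs IH k x ts us ss1 rs L H1 H2.
    inversion H1 as [|? ? ? ? t1 t2 ? ? Et H3 H4]; subst.
    inversion H2 as [|? ? ? ? w1 w2 ? ? Eu H5 H6]; subst.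
    destruct (IHs _ _ _ _ _ _ L H3 H5) as (a1 & a2 & s' & t1' & Ea & A1 & A2 & A3).
    destruct (IH _ _ _ _ _ _ L H4 H6) as (b1 & b2 & ss' & t2' & Eb & B1 & B2 & B3).
    destruct (dsubs_perm_terms _ _ _ _ _ (Permutation_sym Et)
      (dsubs_app _ _ _ _ _ _ _ A2 B2)) as (ts' & E' & H').
    exists (a1 ++ b1), (a2 ++ b2), (s' :: ss'), ts'. repeat split.
    + perm.
    + rewrite map_app. now apply dsubs_cons with (map (lift k) a1) (map (lift k) b1).
    + exact H'.
    + apply dsubs_cons with t1' t2'; auto. now symmetry.
Qed.

Lemma dsub_dsub_merge_mut :
  (forall s k x ts u1 u2 s' ts' r, k <= x ->
     dsub (S x) s (map (lift k) u1) s' -> dsubs x ts u2 ts' -> dsub k s' ts' r ->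
     exists s1, dsub k s ts s1 /\ dsub x s1 (u1 ++ u2) r) /\
  (forall ss k x ts u1 u2 ss' ts' rs, k <= x ->
     dsubs (S x) ss (map (lift k) u1) ss' -> dsubs x ts u2 ts' ->
     dsubs k ss' ts' rs ->
     exists ss1, dsubs k ss ts ss1 /\ dsubs x ss1 (u1 ++ u2) rs).
Proof.
  apply term_terms_ind.
  - intros i k x ts u1 u2 s' ts' r L H1 H2 H3.
    inversion H1 as [? u E1 E2 E3|? ? N E1 E2 E3| | | |]; subst.
    + destruct u1 as [|v [|]]; try discriminate. injection E3 as E3; subst.
      apply dsub_lift_cancel in H3 as [-> ->]. inversion H2; subst.
      eexists. split; [constructor; lia|].
      replace (if S x <? k then S x else pred (S x)) with x
        by (case_ltb; lia). constructor.
    + destruct u1; [|discriminate]. simpl.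
      inversion H3 as [? u E|? ? N' E| | | |]; subst.
      * inversion H2 as [|? t ts0 ? v1 v2 ? ? E' H4 H5]; subst.
        inversion H5; subst. rewrite app_nil_r in E'.
        exists t. split; [|eapply dsub_perm; [symmetry|]; eassumption].
        replace (if i <? S x then i else pred i) with i by (case_ltb; lia).
        constructor.
      * inversion H2; subst.
        eexists. split; [constructor; case_ltb; lia|].
        match goal with |- dsub _ (Var ?j) _ (Var ?k') => replace k' with
          (if j <? x then j else pred j) by (case_ltb; lia) end.
        constructor. case_ltb; lia.
  - intros s IH k x ts u1 u2 s' ts' r L H1 H2 H3.
    inversion H1 as [| |? ? ? s'0 H4| | |]; subst.
    inversion H3; subst. rewrite <- map_lift_lift in *.
    edestruct (IH (S k) (S x) (map (lift 0) ts) (map (lift 0) u1)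
      (map (lift 0) u2) s'0 (map (lift 0) ts')) as (s1 & Ha & Hb);
      [lia|eassumption| |eassumption|].
    { apply dsubs_lift_below; [lia|]. eauto. }
    rewrite <- map_app in Hb. eexists. split; constructor; eassumption.
  - intros s ss IH k x ts u1 u2 s' ts' r L H1 H2 H3. inversion H1; subst.
    inversion H3; subst.
    edestruct IH as (ss1 & Ha & Hb); [eassumption..|].
    inversion Ha; subst. eexists. split; constructor; eassumption.
  - intros s IH k x ts u1 u2 s' ts' r L H1 H2 H3. inversion H1; subst.
    inversion H3; subst.
    edestruct IH as (s1 & Ha & Hb); [eassumption..|].
    eexists. split; constructor; eassumption.
  - intros s IH k x ts u1 u2 s' ts' r L H1 H2 H3. inversion H1; subst.
    inversion H3; subst.
    edestruct IH as (s1 & Ha & Hb); [eassumption..|].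
    eexists. split; constructor; eassumption.
  - intros k x ts u1 u2 ss' ts' rs L H1 H2 H3. inversion H1; subst.
    inversion H3; subst. inversion H2; subst.
    destruct u1; [|discriminate]. exists []. split; constructor.
  - intros s ss IHs IH k x ts u1 u2 ss' ts' rs L H1 H2 H3.
    inversion H1 as [|? ? ? ? t1 t2 ? ? Et H4 H5]; subst.
    inversion H3 as [|? ? ? ? w1 w2 ? ? Ew H6 H7]; subst.
    apply permutation_map_app_inv in Et as (v1 & v2 & -> & -> & Ev).
    (* The bag is reordered so that the arguments consumed by the head come first, and is then cut
       at that point. *)
    destruct (dsubs_perm_results _ _ _ _ _ Ew H2) as (tt & Ett & H8).
    apply dsubs_app_result in H8 as (tt1 & tt2 & x1 & x2 & -> & Ex & H8 & H9).
    destruct (IHs _ _ _ _ _ _ _ _ L H4 H8 H6) as (s1 & A1 & A2).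
    destruct (IH _ _ _ _ _ _ _ _ L H5 H9 H7) as (ss1 & B1 & B2).
    exists (s1 :: ss1). split.
    + now apply dsubs_cons with tt1 tt2.
    + apply dsubs_cons with (v1 ++ x1) (v2 ++ x2); auto. perm.
Qed.
(** * Reduction to predicates *)

Definition image {A B} (f : A -> B) (S : A -> Prop) (b : B) : Prop :=
  exists a, S a /\ b = f a.

(* Only the support of the right-hand side of a reduction is kept: coefficients
   in nat cannot cancel, so multiplicities do not affect supports. *)
Inductive st : term -> (term -> Prop) -> Prop :=
| st_beta s ts : st (App (Lam s) ts) (dsub 0 s ts)
| st_app_chl s ts : st (App (ChL s) ts) (eq (ChL (App s ts)))
| st_app_chr s ts : st (App (ChR s) ts) (eq (ChR (App s ts)))
| st_lam_chl s : st (Lam (ChL s)) (eq (ChL (Lam s)))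
| st_lam_chr s : st (Lam (ChR s)) (eq (ChR (Lam s)))
| st_lam s S : st s S -> st (Lam s) (image Lam S)
| st_app s ts T : sts (s :: ts) T ->
    st (App s ts) (fun r => exists s' ts', T (s' :: ts') /\ r = App s' ts')
| st_chl s S : st s S -> st (ChL s) (image ChL S)
| st_chr s S : st s S -> st (ChR s) (image ChR S)
with sts : list term -> (list term -> Prop) -> Prop :=
| sts_head t ts S : st t S -> sts (t :: ts) (image (fun t' => t' :: ts) S)
| sts_tail t ts T : sts ts T -> sts (t :: ts) (image (cons t) T).

Scheme st_mut := Minimality for st Sort Prop
  with sts_mut := Minimality for sts Sort Prop.
Combined Scheme st_sts_ind from st_mut, sts_mut.

Lemma tred_st :
  (forall t T, tred t T -> exists S, st t S /\ forall r, In r T <-> S r) /\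
  (forall ts T, mred ts T -> exists S, sts ts S /\ forall r, In r T <-> S r).
Proof.
  assert (Hmap : forall A B (f : A -> B) (T : list A) (S : A -> Prop),
    (forall a, In a T <-> S a) -> forall b, In b (map f T) <-> image f S b).
  { intros A B f T S E b. rewrite in_map_iff. unfold image.
    split; intros (a & H1 & H2); exists a; rewrite ?E in *; auto;
      split; auto; now apply E. }
  assert (Hone : forall A (a b : A), In b [a] <-> a = b)
    by (intros; simpl; tauto).
  apply tred_mred_ind.
  - intros s ts. eexists. split; [constructor|]. intros. apply in_deriv.
  - eexists. split; [constructor|]. auto.
  - eexists. split; [constructor|]. auto.
  - eexists. split; [constructor|]. auto.
  - eexists. split; [constructor|]. auto.
  - intros s S _ (P & HP & E). eexists. split; [constructor; exact HP|]. auto.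
  - intros s ts S _ (P & HP & E). eexists.
    split; [apply st_app, sts_head; exact HP|].
    intros r. rewrite (Hmap _ _ _ _ _ E). split.
    + intros (s' & H & ->). exists s', ts. split; [|reflexivity]. now exists s'.
    + intros (s' & ts' & (s'' & H & E') & ->). injection E' as -> ->.
      now exists s''.
  - intros s ts T _ (P & HP & E). eexists.
    split; [apply st_app, sts_tail; exact HP|].
    intros r. rewrite (Hmap _ _ _ _ _ E). split.
    + intros (ts' & H & ->). exists s, ts'. split; [|reflexivity]. now exists ts'.
    + intros (s' & ts' & (ts'' & H & E') & ->). injection E' as -> ->.
      now exists ts''.
  - intros s S _ (P & HP & E). eexists. split; [constructor; exact HP|]. auto.
  - intros s S _ (P & HP & E). eexists. split; [constructor; exact HP|]. auto.
  - intros t ts S _ (P & HP & E). eexists. split; [constructor; exact HP|]. auto.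
  - intros t ts S _ (P & HP & E). eexists.
    split; [apply sts_tail; exact HP|]. auto.
Qed.

(** The clause on [App s us] is there because [sts] counts the function of an application as the
    head of its bag: a list step can come from [tred_fun] as well as from [tred_arg]. *)
Lemma st_tred :
  (forall t S, st t S -> exists T, tred t T /\ forall r, S r -> In r T) /\
  (forall ts S, sts ts S -> exists T, mred ts T /\ (forall r, S r -> In r T) /\
     forall s us, ts = s :: us -> exists T', tred (App s us) T' /\
       forall s' us', S (s' :: us') -> In (App s' us') T').
Proof.
  apply st_sts_ind.
  - intros s ts. eexists. split; [constructor|]. intros. now apply in_deriv.
  - eexists. split; [constructor|]. intros. now left.
  - eexists. split; [constructor|]. intros. now left.
  - eexists. split; [constructor|]. intros. now left.
  - eexists. split; [constructor|]. intros. now left.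
  - intros s S _ (T & HT & E). eexists. split; [constructor; exact HT|].
    intros r (s' & H & ->). auto using in_map.
  - intros s ts S _ (T & _ & _ & H). destruct (H s ts eq_refl) as (T' & HT' & E).
    exists T'. split; [exact HT'|]. intros r (s' & ts' & H' & ->). auto.
  - intros s S _ (T & HT & E). eexists. split; [constructor; exact HT|].
    intros r (s' & H & ->). auto using in_map.
  - intros s S _ (T & HT & E). eexists. split; [constructor; exact HT|].
    intros r (s' & H & ->). auto using in_map.
  - intros t ts S _ (T & HT & E). eexists. split; [constructor; exact HT|]. split.
    + intros r (s' & H & ->). apply (in_map (fun t' => t' :: ts)). auto.
    + intros s us E'. injection E' as <- <-. eexists.
      split; [apply tred_fun; exact HT|].
      intros s' us' (t' & H & E'). injection E' as -> ->.
      apply (in_map (fun t' => App t' ts)). auto.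
  - intros t ts S _ (T & HT & E & _). eexists.
    split; [apply mred_tail; exact HT|]. split.
    + intros r (s' & H & ->). auto using in_map.
    + intros s us E'. injection E' as <- <-. eexists.
      split; [apply tred_arg; exact HT|].
      intros s' us' (ts' & H & E'). injection E' as -> ->. auto using in_map.
Qed.

Lemma sts_split ts T : sts ts T -> exists a t b S, ts = a ++ t :: b /\ st t S /\
  forall l, T l <-> exists t', S t' /\ l = a ++ t' :: b.
Proof.
  revert T. induction ts as [|t ts IH]; intros T H; inversion H; subst.
  - exists [], t, ts, S. repeat split; auto.
  - destruct (IH T0) as (a & u & b & S & -> & HS & E); [assumption|].
    exists (t :: a), u, b, S. repeat split; auto.
    + intros (l' & Hl & ->). apply E in Hl as (t' & Ht & ->). eauto.
    + intros (t' & Ht & ->). exists (a ++ t' :: b). split; [|reflexivity].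
      apply E. eauto.
Qed.

(** * Commutation of reduction with lifting and linear substitution *)

Lemma st_lift_mut :
  (forall t S, st t S -> forall c, exists S', st (lift c t) S' /\
     forall r, S' r <-> image (lift c) S r) /\
  (forall ts T, sts ts T -> forall c, exists T', sts (map (lift c) ts) T' /\
     forall rs, T' rs <-> image (map (lift c)) T rs).
Proof.
  apply st_sts_ind.
  - intros s ts c. eexists. split; [constructor|]. intros r.
    rewrite dsub_lift_above by lia. split; intros (r0 & H1 & H2); exists r0; auto.
  - intros s ts c. eexists. split; [constructor|]. intros r. split.
    + intros <-. eexists. split; reflexivity.
    + intros (r0 & <- & ->). reflexivity.
  - intros s ts c. eexists. split; [constructor|]. intros r. split.
    + intros <-. eexists. split; reflexivity.
    + intros (r0 & <- & ->). reflexivity.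
  - intros s c. eexists. split; [constructor|]. intros r. split.
    + intros <-. eexists. split; reflexivity.
    + intros (r0 & <- & ->). reflexivity.
  - intros s c. eexists. split; [constructor|]. intros r. split.
    + intros <-. eexists. split; reflexivity.
    + intros (r0 & <- & ->). reflexivity.
  - intros s S _ IH c. destruct (IH (Datatypes.S c)) as (S' & HS & E).
    eexists. split; [simpl; constructor; exact HS|]. intros r. split.
    + intros (r0 & H & ->). apply E in H as (r1 & H & ->).
      exists (Lam r1). split; [|reflexivity]. now exists r1.
    + intros (r0 & (r1 & H & ->) & ->). exists (lift (Datatypes.S c) r1).
      split; [|reflexivity]. apply E. now exists r1.
  - intros s ts T _ IH c. destruct (IH c) as (T' & HT & E).
    eexists. split; [simpl; constructor; exact HT|]. intros r. split.
    + intros (s' & ts' & H & ->). apply E in H as ([|r rs] & H & E');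
        [discriminate|]. injection E' as -> ->.
      exists (App r rs). split; [|reflexivity]. eauto.
    + intros (r0 & (s' & ts' & H & ->) & ->). simpl.
      do 2 eexists. split; [|reflexivity]. apply E. now exists (s' :: ts').
  - intros s S _ IH c. destruct (IH c) as (S' & HS & E).
    eexists. split; [simpl; constructor; exact HS|]. intros r. split.
    + intros (r0 & H & ->). apply E in H as (r1 & H & ->).
      exists (ChL r1). split; [|reflexivity]. now exists r1.
    + intros (r0 & (r1 & H & ->) & ->). exists (lift c r1).
      split; [|reflexivity]. apply E. now exists r1.
  - intros s S _ IH c. destruct (IH c) as (S' & HS & E).
    eexists. split; [simpl; constructor; exact HS|]. intros r. split.
    + intros (r0 & H & ->). apply E in H as (r1 & H & ->).
      exists (ChR r1). split; [|reflexivity]. now exists r1.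
    + intros (r0 & (r1 & H & ->) & ->). exists (lift c r1).
      split; [|reflexivity]. apply E. now exists r1.
  - intros t ts S _ IH c. destruct (IH c) as (S' & HS & E).
    eexists. split; [simpl; apply sts_head; exact HS|]. intros r. split.
    + intros (r0 & H & ->). apply E in H as (r1 & H & ->).
      exists (r1 :: ts). split; [|reflexivity]. now exists r1.
    + intros (r0 & (r1 & H & ->) & ->). exists (lift c r1).
      split; [|reflexivity]. apply E. now exists r1.
  - intros t ts S _ IH c. destruct (IH c) as (S' & HS & E).
    eexists. split; [simpl; apply sts_tail; exact HS|]. intros r. split.
    + intros (r0 & H & ->). apply E in H as (r1 & H & ->).
      exists (t :: r1). split; [|reflexivity]. now exists r1.
    + intros (r0 & (r1 & H & ->) & ->). exists (map (lift c) r1).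
      split; [|reflexivity]. apply E. now exists r1.
Qed.

Lemma st_lift t S c : st t S ->
  exists S', st (lift c t) S' /\ forall r, S' r <-> image (lift c) S r.
Proof. intros H. now apply st_lift_mut. Qed.

(** Substitution keeps the constructors around the redex, so the same redex can be fired in [r]. For
    a beta redex, the inclusion is the merging half of the chain rule. *)
Lemma dsub_st_forward_mut :
  (forall s S, st s S -> forall x us r, dsub x s us r ->
     exists R, st r R /\ forall r', R r' -> exists s', S s' /\ dsub x s' us r') /\
  (forall ts T, sts ts T -> forall x us rs, dsubs x ts us rs ->
     exists R, sts rs R /\
       forall rs', R rs' -> exists ts', T ts' /\ dsubs x ts' us rs').
Proof.
  apply st_sts_ind.
  - intros s ts x us r H. inversion H as [| | |? ? ? ? ? rs H0| |]; subst.
    inversion H0 as [|? ? ? ? u1 u2 ? ? E H1 H2]; subst.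
    inversion H1 as [| |? ? ? q H3| | |]; subst.
    exists (dsub 0 q rs). split; [constructor|]. intros r' H'.
    edestruct dsub_dsub_merge_mut as [HM _].
    destruct (HM _ _ _ _ _ _ _ _ _ (Nat.le_0_l x) H3 H2 H') as (s1 & Ha & Hb).
    exists s1. split; [exact Ha|]. eapply dsub_perm; [symmetry|]; eassumption.
  - intros s ts x us r H. inversion H as [| | |? ? ? ? ? rs H0| |]; subst.
    inversion H0 as [|? ? ? ? u1 u2 ? ? E H1 H2]; subst.
    inversion H1; subst. eexists. split; [constructor|]. intros r' <-.
    eexists. split; [reflexivity|]. do 2 constructor. econstructor; eassumption.
  - intros s ts x us r H. inversion H as [| | |? ? ? ? ? rs H0| |]; subst.
    inversion H0 as [|? ? ? ? u1 u2 ? ? E H1 H2]; subst.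
    inversion H1; subst. eexists. split; [constructor|]. intros r' <-.
    eexists. split; [reflexivity|]. do 2 constructor. econstructor; eassumption.
  - intros s x us r H. inversion H as [| |? ? ? ? H0| | |]; subst.
    inversion H0; subst. eexists. split; [constructor|]. intros r' <-.
    eexists. split; [reflexivity|]. now do 2 constructor.
  - intros s x us r H. inversion H as [| |? ? ? ? H0| | |]; subst.
    inversion H0; subst. eexists. split; [constructor|]. intros r' <-.
    eexists. split; [reflexivity|]. now do 2 constructor.
  - intros s S _ IH x us r H. inversion H as [| |? ? ? r0 H0| | |]; subst.
    apply IH in H0 as (R & HR & E). eexists. split; [constructor; exact HR|].
    intros r' (r1 & H1 & ->). apply E in H1 as (s' & Hs & H1).
    exists (Lam s'). split; [now exists s'|]. now constructor.
  - intros s ts T _ IH x us r H. inversion H as [| | |? ? ? ? r0 rs H0| |]; subst.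
    apply IH in H0 as (R & HR & E). eexists. split; [constructor; exact HR|].
    intros r' (s1 & ts1 & H1 & ->). apply E in H1 as (l & Hl & H1).
    inversion H1; subst. eexists. split; [eauto|]. now constructor.
  - intros s S _ IH x us r H. inversion H as [| | | |? ? ? r0 H0|]; subst.
    apply IH in H0 as (R & HR & E). eexists. split; [constructor; exact HR|].
    intros r' (r1 & H1 & ->). apply E in H1 as (s' & Hs & H1).
    exists (ChL s'). split; [now exists s'|]. now constructor.
  - intros s S _ IH x us r H. inversion H as [| | | | |? ? ? r0 H0]; subst.
    apply IH in H0 as (R & HR & E). eexists. split; [constructor; exact HR|].
    intros r' (r1 & H1 & ->). apply E in H1 as (s' & Hs & H1).
    exists (ChR s'). split; [now exists s'|]. now constructor.
  - intros t ts S _ IH x us rs H.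
    inversion H as [|? ? ? ? u1 u2 r0 rs0 E H1 H2]; subst.
    apply IH in H1 as (R & HR & E'). eexists. split; [apply sts_head; exact HR|].
    intros rs' (r1 & H1 & ->). apply E' in H1 as (s' & Hs & H1).
    exists (s' :: ts). split; [now exists s'|]. econstructor; eassumption.
  - intros t ts T _ IH x us rs H.
    inversion H as [|? ? ? ? u1 u2 r0 rs0 E H1 H2]; subst.
    apply IH in H2 as (R & HR & E'). eexists. split; [apply sts_tail; exact HR|].
    intros rs' (r1 & H2 & ->). apply E' in H2 as (ts' & Hs & H2).
    exists (t :: ts'). split; [now exists ts'|]. econstructor; eassumption.
Qed.

(** Complement of the forward lemma: the reducts of the various [r] exhaust what substitution yields
    from the reduct of [s]. For a beta redex this is the splitting half of the chain rule. *)
Lemma dsub_st_backward_mut :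
  (forall s S, st s S -> forall x us s' r', S s' -> dsub x s' us r' ->
     exists r R, dsub x s us r /\ st r R /\ R r') /\
  (forall ts T, sts ts T -> forall x us ts' rs', T ts' -> dsubs x ts' us rs' ->
     exists rs R, dsubs x ts us rs /\ sts rs R /\ R rs').
Proof.
  apply st_sts_ind.
  - intros s ts x us s' r' Hs H.
    edestruct dsub_dsub_split_mut as [HM _].
    destruct (HM _ _ _ _ _ _ _ (Nat.le_0_l x) Hs H)
      as (u1 & u2 & s1 & ts1 & E & Ha & Hb & Hc).
    exists (App (Lam s1) ts1), (dsub 0 s1 ts1).
    split; [|split; [constructor|exact Hc]].
    constructor. econstructor; [exact E| |exact Hb]. now constructor.
  - intros s ts x us s' r' <- H. inversion H as [| | | |? ? ? ? H0|]; subst.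
    inversion H0 as [| | |? ? ? ? r0 rs0 H1| |]; subst. inversion H1; subst.
    eexists. eexists. split; [|split; [constructor|reflexivity]].
    constructor. econstructor; [eassumption| |eassumption]. now constructor.
  - intros s ts x us s' r' <- H. inversion H as [| | | | |? ? ? ? H0]; subst.
    inversion H0 as [| | |? ? ? ? r0 rs0 H1| |]; subst. inversion H1; subst.
    eexists. eexists. split; [|split; [constructor|reflexivity]].
    constructor. econstructor; [eassumption| |eassumption]. now constructor.
  - intros s x us s' r' <- H. inversion H as [| | | |? ? ? ? H0|]; subst.
    inversion H0; subst.
    eexists. eexists. split; [|split; [constructor|reflexivity]].
    now do 2 constructor.
  - intros s x us s' r' <- H. inversion H as [| | | | |? ? ? ? H0]; subst.
    inversion H0; subst.
    eexists. eexists. split; [|split; [constructor|reflexivity]].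
    now do 2 constructor.
  - intros s S _ IH x us s' r' (s1 & Hs & ->) H.
    inversion H as [| |? ? ? r0 H0| | |]; subst.
    destruct (IH _ _ _ _ Hs H0) as (r & R & Ha & Hb & Hc).
    exists (Lam r), (image Lam R). repeat split; [now constructor..|].
    now exists r0.
  - intros s ts T _ IH x us s' r' (s1 & ts1 & Hs & ->) H.
    inversion H as [| | |? ? ? ? r0 rs0 H0| |]; subst.
    destruct (IH _ _ _ _ Hs H0) as (rs & R & Ha & Hb & Hc).
    inversion Ha; subst. eexists. eexists.
    split; [constructor; exact Ha|]. split; [constructor; exact Hb|].
    do 2 eexists. split; [exact Hc|reflexivity].
  - intros s S _ IH x us s' r' (s1 & Hs & ->) H.
    inversion H as [| | | |? ? ? r0 H0|]; subst.
    destruct (IH _ _ _ _ Hs H0) as (r & R & Ha & Hb & Hc).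
    exists (ChL r), (image ChL R). repeat split; [now constructor..|].
    now exists r0.
  - intros s S _ IH x us s' r' (s1 & Hs & ->) H.
    inversion H as [| | | | |? ? ? r0 H0]; subst.
    destruct (IH _ _ _ _ Hs H0) as (r & R & Ha & Hb & Hc).
    exists (ChR r), (image ChR R). repeat split; [now constructor..|].
    now exists r0.
  - intros t ts S _ IH x us ts' rs' (t1 & Ht & ->) H.
    inversion H as [|? ? ? ? u1 u2 r0 rs0 E H1 H2]; subst.
    destruct (IH _ _ _ _ Ht H1) as (r & R & Ha & Hb & Hc).
    eexists. eexists. split; [econstructor; eassumption|].
    split; [apply sts_head; exact Hb|]. now exists r0.
  - intros t ts S _ IH x us ts' rs' (t1 & Ht & ->) H.
    inversion H as [|? ? ? ? u1 u2 r0 rs0 E H1 H2]; subst.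
    destruct (IH _ _ _ _ Ht H2) as (r & R & Ha & Hb & Hc).
    eexists. eexists. split; [econstructor; eassumption|].
    split; [apply sts_tail; exact Hb|]. now exists rs0.
Qed.

(** By linearity [t] sits at exactly one occurrence in [r], possibly lifted, so its step is exactly
    one step of [r]. *)
Lemma dsub_arg_forward_mut :
  (forall s x t us r S, st t S -> dsub x s (t :: us) r ->
     exists R, st r R /\ forall r', R r' ->
       exists t', S t' /\ dsub x s (t' :: us) r') /\
  (forall ss x t us rs S, st t S -> dsubs x ss (t :: us) rs ->
     exists R, sts rs R /\ forall rs', R rs' ->
       exists t', S t' /\ dsubs x ss (t' :: us) rs').
Proof.
  apply term_terms_ind.
  - intros i x t us r S HS H. inversion H; subst. exists S.
    split; [exact HS|]. intros r' Hr. exists r'. split; [exact Hr|]. constructor.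
  - intros s IH x t us r S HS H. inversion H as [| |? ? ? r0 H0| | |]; subst.
    destruct (st_lift _ _ 0 HS) as (S' & HS' & E).
    destruct (IH _ _ _ _ _ HS' H0) as (R & HR & E').
    eexists. split; [constructor; exact HR|]. intros r' (r1 & Hr & ->).
    apply E' in Hr as (t' & Ht & Hr). apply E in Ht as (t0 & Ht & ->).
    exists t0. split; [exact Ht|]. now constructor.
  - intros s ss IH x t us r S HS H.
    inversion H as [| | |? ? ? ? r0 rs0 H0| |]; subst.
    destruct (IH _ _ _ _ _ HS H0) as (R & HR & E').
    eexists. split; [constructor; exact HR|]. intros r' (s1 & ts1 & Hr & ->).
    apply E' in Hr as (t' & Ht & Hr). exists t'. split; [exact Ht|]. now constructor.
  - intros s IH x t us r S HS H. inversion H as [| | | |? ? ? r0 H0|]; subst.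
    destruct (IH _ _ _ _ _ HS H0) as (R & HR & E').
    eexists. split; [constructor; exact HR|]. intros r' (r1 & Hr & ->).
    apply E' in Hr as (t' & Ht & Hr). exists t'. split; [exact Ht|]. now constructor.
  - intros s IH x t us r S HS H. inversion H as [| | | | |? ? ? r0 H0]; subst.
    destruct (IH _ _ _ _ _ HS H0) as (R & HR & E').
    eexists. split; [constructor; exact HR|]. intros r' (r1 & Hr & ->).
    apply E' in Hr as (t' & Ht & Hr). exists t'. split; [exact Ht|]. now constructor.
  - intros x t us rs S HS H. inversion H.
  - intros s ss IHs IH x t us rs S HS H.
    inversion H as [|? ? ? ? u1 u2 r0 rs0 E H1 H2]; subst.
    apply permutation_cons_app in E as [(v & E1 & E2)|(v & E1 & E2)].
    + destruct (IHs _ _ _ _ _ HS (dsub_perm _ _ _ _ _ E1 H1)) as (R & HR & E').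
      eexists. split; [apply sts_head; exact HR|]. intros r' (r1 & Hr & ->).
      apply E' in Hr as (t' & Ht & Hr). exists t'. split; [exact Ht|].
      apply dsubs_cons with (t' :: v) u2; auto. simpl. now constructor.
    + destruct (IH _ _ _ _ _ HS (dsubs_perm _ _ _ _ _ E1 H2)) as (R & HR & E').
      eexists. split; [apply sts_tail; exact HR|]. intros r' (r1 & Hr & ->).
      apply E' in Hr as (t' & Ht & Hr). exists t'. split; [exact Ht|].
      apply dsubs_cons with u1 (t' :: v); auto.
      rewrite E2. apply Permutation_middle.
Qed.

(** [r] is obtained from [r'] by putting [t] back at the unique place where [t'] was substituted. *)
Lemma dsub_arg_backward_mut :
  (forall s x t us t' r' S, st t S -> S t' -> dsub x s (t' :: us) r' ->
     exists r R, dsub x s (t :: us) r /\ st r R /\ R r') /\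
  (forall ss x t us t' rs' S, st t S -> S t' -> dsubs x ss (t' :: us) rs' ->
     exists rs R, dsubs x ss (t :: us) rs /\ sts rs R /\ R rs').
Proof.
  apply term_terms_ind.
  - intros i x t us t' r' S HS Ht H. inversion H; subst.
    exists t, S. repeat split; auto. constructor.
  - intros s IH x t us t' r' S HS Ht H. inversion H as [| |? ? ? r0 H0| | |]; subst.
    destruct (st_lift _ _ 0 HS) as (S' & HS' & E).
    assert (Ht' : S' (lift 0 t')) by (apply E; now exists t').
    destruct (IH _ _ _ _ _ _ HS' Ht' H0) as (r & R & Ha & Hb & Hc).
    exists (Lam r), (image Lam R). repeat split; [now constructor..|].
    now exists r0.
  - intros s ss IH x t us t' r' S HS Ht H.
    inversion H as [| | |? ? ? ? r0 rs0 H0| |]; subst.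
    destruct (IH _ _ _ _ _ _ HS Ht H0) as (rs & R & Ha & Hb & Hc).
    inversion Ha; subst. eexists. eexists.
    split; [constructor; exact Ha|]. split; [constructor; exact Hb|].
    do 2 eexists. split; [exact Hc|reflexivity].
  - intros s IH x t us t' r' S HS Ht H. inversion H as [| | | |? ? ? r0 H0|]; subst.
    destruct (IH _ _ _ _ _ _ HS Ht H0) as (r & R & Ha & Hb & Hc).
    exists (ChL r), (image ChL R). repeat split; [now constructor..|].
    now exists r0.
  - intros s IH x t us t' r' S HS Ht H. inversion H as [| | | | |? ? ? r0 H0]; subst.
    destruct (IH _ _ _ _ _ _ HS Ht H0) as (r & R & Ha & Hb & Hc).
    exists (ChR r), (image ChR R). repeat split; [now constructor..|].
    now exists r0.
  - intros x t us t' rs' S HS Ht H. inversion H.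
  - intros s ss IHs IH x t us t' rs' S HS Ht H.
    inversion H as [|? ? ? ? u1 u2 r0 rs0 E H1 H2]; subst.
    apply permutation_cons_app in E as [(v & E1 & E2)|(v & E1 & E2)].
    + destruct (IHs _ _ _ _ _ _ HS Ht (dsub_perm _ _ _ _ _ E1 H1))
        as (r & R & Ha & Hb & Hc).
      exists (r :: rs0), (image (fun r => r :: rs0) R).
      split; [|split; [now apply sts_head|now exists r0]].
      apply dsubs_cons with (t :: v) u2; auto. simpl. now constructor.
    + destruct (IH _ _ _ _ _ _ HS Ht (dsubs_perm _ _ _ _ _ E1 H2))
        as (rs & R & Ha & Hb & Hc).
      exists (r0 :: rs), (image (cons r0) R).
      split; [|split; [now apply sts_tail|now exists rs0]].
      apply dsubs_cons with u1 (t :: v); auto.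
      rewrite E2. apply Permutation_middle.
Qed.

Lemma dsub_args_forward x s ts T r : sts ts T -> dsub x s ts r ->
  exists R, st r R /\ forall r', R r' -> exists ts', T ts' /\ dsub x s ts' r'.
Proof.
  intros HT H. apply sts_split in HT as (a & t & b & S & -> & HS & E).
  apply (dsub_perm _ _ _ (t :: a ++ b)) in H;
    [|symmetry; apply Permutation_middle].
  destruct (proj1 dsub_arg_forward_mut _ _ _ _ _ _ HS H) as (R & HR & E').
  exists R. split; [exact HR|]. intros r' Hr.
  apply E' in Hr as (t' & Ht & Hr). exists (a ++ t' :: b).
  split; [apply E; eauto|]. revert Hr. apply dsub_perm, Permutation_middle.
Qed.

Lemma dsub_args_backward x s ts T ts' r' : sts ts T -> T ts' -> dsub x s ts' r' ->
  exists r R, dsub x s ts r /\ st r R /\ R r'.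
Proof.
  intros HT Ht H. apply sts_split in HT as (a & t & b & S & -> & HS & E).
  apply E in Ht as (t' & Ht & ->).
  apply (dsub_perm _ _ _ (t' :: a ++ b)) in H;
    [|symmetry; apply Permutation_middle].
  destruct (proj1 dsub_arg_backward_mut _ _ _ _ _ _ _ HS Ht H)
    as (r & R & Ha & Hb & Hc).
  exists r, R. split; [|auto]. revert Ha. apply dsub_perm, Permutation_middle.
Qed.
(** * Local confluence and invariance of reachable normal forms *)

Section Covering.
Context {A : Type} (red : A -> (A -> Prop) -> Prop).

Definition step (a b : A) : Prop := exists S, red a S /\ S b.
Definition steps : A -> A -> Prop := clos_refl_trans A step.

(** Reduction of the one-summand sum [a] to a sum supported in [Q], one branch per summand; a reduct
    equal to zero is covered vacuously. *)
Inductive covers (Q : A -> Prop) : A -> Prop :=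
| covers_now a : Q a -> covers Q a
| covers_step a S : red a S -> (forall b, S b -> covers Q b) -> covers Q a.

(* All the summands of some reduct of [a] are reachable from [H]. *)
Definition joins (H : A -> Prop) : A -> Prop :=
  covers (fun u => exists h, H h /\ steps h u).

Lemma joins_same (H : A -> Prop) a : H a -> joins H a.
Proof. intros Ha. apply covers_now. exists a. split; [exact Ha|]. apply rt_refl. Qed.

Lemma joins_reached (H : A -> Prop) h a : H h -> step h a -> joins H a.
Proof. intros Hh S. apply covers_now. exists h. split; [exact Hh|]. now apply rt_step. Qed.
End Covering.

Lemma steps_map {A B} redA redB (f : A -> B) :
  (forall a b, step redA a b -> step redB (f a) (f b)) ->
  forall a b, steps redA a b -> steps redB (f a) (f b).
Proof.
  intros Hf a b H. induction H.
  - apply rt_step. auto.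
  - apply rt_refl.
  - eapply rt_trans; eassumption.
Qed.

(** The reduct in the context is described only pointwise, because [st_app] does not produce a
    predicate that is literally an [image]. *)
Lemma joins_map {A B} redA redB (f : A -> B) :
  (forall a S, redA a S ->
     exists S', redB (f a) S' /\ forall b, S' b <-> image f S b) ->
  forall H H' a, (forall h, H h -> H' (f h)) ->
    joins redA H a -> joins redB H' (f a).
Proof.
  intros Hf H H' a HH HJ.
  induction HJ as [a (h & Hh & Hs)|a S HS _ IH].
  - apply covers_now. exists (f h). split; [now apply HH|].
    revert Hs. apply steps_map. intros b c (S & HS & Sc).
    destruct (Hf _ _ HS) as (S' & HS' & E). exists S'. split; [exact HS'|].
    apply E. now exists c.
  - destruct (Hf _ _ HS) as (S' & HS' & E). apply covers_step with S'; [exact HS'|].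
    intros b Hb. apply E in Hb as (c & Hc & ->). exact (IH _ Hc).
Qed.

(** Turns application into a unary context on lists, so that [joins_map] passes from [sts] to [st].
    The value at [[]] is a default: [sts] never relates [[]] to anything and has only nonempty lists
    in its reducts. *)
Definition app_list (l : list term) : term :=
  match l with s :: ts => App s ts | [] => Var 0 end.

Lemma st_app_list l T : sts l T ->
  exists S, st (app_list l) S /\ forall r, S r <-> image app_list T r.
Proof.
  intros H. destruct l as [|s ts]; [inversion H|]. eexists.
  split; [constructor; exact H|]. intros r. split.
  - intros (s' & ts' & H' & ->). now exists (s' :: ts').
  - intros ([|s' ts'] & H' & ->); [inversion H; subst; now destruct H' as (? & ? & ?)|].
    simpl. eauto.
Qed.

(** Since [joins] treats its two steps differently, each critical pair comes twice: in a lemma named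
    [..._joins] the named redex yields the predicate to reach from, in [joins_...] it yields the
    summand to be joined. *)
Lemma beta_joins s ts T t : st (App (Lam s) ts) T -> T t ->
  joins st (dsub 0 s ts) t.
Proof.
  intros HT Ht. inversion HT as [| | | | | |? ? T0 HT0| |]; subst.
  - now apply joins_same.
  - destruct Ht as (s' & ts' & Ht & ->).
    inversion HT0 as [? ? S HS|? ? T HT1]; subst.
    + destruct Ht as (x & Hx & E). injection E as -> ->.
      inversion HS as [| | |s0|s0|? S0 HS0| | |]; subst.
      (* The choice has left the abstraction; it now crosses the application, and the beta redex
         below it then gives summands of the other reduct. *)
      * subst x. eapply covers_step; [constructor|]. intros r <-.
        eapply covers_step; [constructor; constructor|].
        intros r (r0 & Hr & ->). apply joins_same. now constructor.
      * subst x. eapply covers_step; [constructor|]. intros r <-.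
        eapply covers_step; [constructor; constructor|].
        intros r (r0 & Hr & ->). apply joins_same. now constructor.
      * destruct Hx as (s1 & Hs1 & ->).
        eapply covers_step; [constructor|]. intros r Hr.
        destruct (proj1 dsub_st_backward_mut _ _ HS0 _ _ _ _ Hs1 Hr)
          as (r0 & R & Ha & Hb & Hc).
        apply joins_reached with r0; [exact Ha|]. now exists R.
    + destruct Ht as (x & Hx & E). injection E as -> ->.
      eapply covers_step; [constructor|]. intros r Hr.
      destruct (dsub_args_backward _ _ _ _ _ _ HT1 Hx Hr)
        as (r0 & R & Ha & Hb & Hc).
      apply joins_reached with r0; [exact Ha|]. now exists R.
Qed.

Lemma joins_beta s ts H t : sts (Lam s :: ts) H -> dsub 0 s ts t ->
  joins st (fun r => exists s' ts', H (s' :: ts') /\ r = App s' ts') t.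
Proof.
  intros HH Ht. inversion HH as [? ? S HS|? ? T HT]; subst.
  - inversion HS as [| | |s0|s0|? S0 HS0| | |]; subst.
    + inversion Ht as [| | | |? ? ? r Hr|]; subst. apply covers_now.
      exists (App (ChL (Lam s0)) ts). split.
      * exists (ChL (Lam s0)), ts. split; [|reflexivity]. eexists. split; reflexivity.
      * eapply rt_trans; apply rt_step.
        -- eexists. split; [constructor|reflexivity].
        -- eexists. split; [constructor; constructor|]. now exists r.
    + inversion Ht as [| | | | |? ? ? r Hr]; subst. apply covers_now.
      exists (App (ChR (Lam s0)) ts). split.
      * exists (ChR (Lam s0)), ts. split; [|reflexivity]. eexists. split; reflexivity.
      * eapply rt_trans; apply rt_step.
        -- eexists. split; [constructor|reflexivity].
        -- eexists. split; [constructor; constructor|]. now exists r.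
    + destruct (proj1 dsub_st_forward_mut _ _ HS0 _ _ _ Ht) as (R & HR & E).
      eapply covers_step; [exact HR|]. intros r Hr.
      apply E in Hr as (s' & Hs & Hr).
      apply joins_reached with (App (Lam s') ts).
      * exists (Lam s'), ts. split; [|reflexivity]. exists (Lam s').
        split; [|reflexivity]. now exists s'.
      * eexists. split; [constructor|exact Hr].
  - destruct (dsub_args_forward _ _ _ _ _ HT Ht) as (R & HR & E).
    eapply covers_step; [exact HR|]. intros r Hr.
    apply E in Hr as (ts' & Hs & Hr).
    apply joins_reached with (App (Lam s) ts').
    + exists (Lam s), ts'. split; [|reflexivity]. now exists ts'.
    + eexists. split; [constructor|exact Hr].
Qed.

(* [C] stands for either of the two choice constructors. *)
Section Choice.
Context (C : term -> term).
Context (C_inj : forall s s', C s = C s' -> s = s').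
Context (st_C : forall s S, st s S -> st (C s) (image C S)).
Context (st_C_inv : forall s S, st (C s) S -> exists S', st s S' /\ S = image C S').
Context (st_app_C : forall s ts, st (App (C s) ts) (eq (C (App s ts)))).
Context (st_lam_C : forall s, st (Lam (C s)) (eq (C (Lam s)))).

Lemma app_choice_joins s ts T0 s' ts' : sts (C s :: ts) T0 -> T0 (s' :: ts') ->
  joins st (eq (C (App s ts))) (App s' ts').
Proof.
  intros HT Ht. inversion HT as [? ? S HS|? ? T HT1]; subst.
  - destruct Ht as (x & Hx & E). injection E as -> ->.
    apply st_C_inv in HS as (S' & HS & ->). destruct Hx as (s1 & Hs & ->).
    eapply covers_step; [apply st_app_C|]. intros r <-.
    eapply joins_reached; [reflexivity|]. eexists.
    split; [apply st_C, st_app, sts_head, HS|].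
    eexists. split; [|reflexivity]. exists s1, ts. split; [|reflexivity].
    now exists s1.
  - destruct Ht as (x & Hx & E). injection E as -> ->.
    eapply covers_step; [apply st_app_C|]. intros r <-.
    eapply joins_reached; [reflexivity|]. eexists.
    split; [apply st_C, st_app, sts_tail, HT1|].
    eexists. split; [|reflexivity]. exists s, x. split; [|reflexivity].
    now exists x.
Qed.

Lemma joins_app_choice s ts H : sts (C s :: ts) H ->
  joins st (fun r => exists s' ts', H (s' :: ts') /\ r = App s' ts')
    (C (App s ts)).
Proof.
  intros HH. inversion HH as [? ? S HS|? ? T HT]; subst.
  - apply st_C_inv in HS as (S' & HS & ->).
    eapply covers_step; [apply st_C, st_app, sts_head, HS|].
    intros r (r1 & (s1 & ts1 & (s2 & Hs & E) & ->) & ->). injection E as -> ->.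
    apply joins_reached with (App (C s2) ts).
    + exists (C s2), ts. split; [|reflexivity]. exists (C s2).
      split; [|reflexivity]. now exists s2.
    + eexists. split; [apply st_app_C|reflexivity].
  - eapply covers_step; [apply st_C, st_app, sts_tail, HT|].
    intros r (r1 & (s1 & ts1 & (s2 & Hs & E) & ->) & ->). injection E as -> ->.
    apply joins_reached with (App (C s) s2).
    + exists (C s), s2. split; [|reflexivity]. now exists s2.
    + eexists. split; [apply st_app_C|reflexivity].
Qed.

Lemma lam_choice_joins s S s' : st (C s) S -> S s' ->
  joins st (eq (C (Lam s))) (Lam s').
Proof.
  intros HS Hs. apply st_C_inv in HS as (S' & HS & ->).
  destruct Hs as (s1 & Hs & ->).
  eapply covers_step; [apply st_lam_C|]. intros r <-.
  eapply joins_reached; [reflexivity|]. eexists.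
  split; [apply st_C, st_lam, HS|]. eexists. split; [|reflexivity]. now exists s1.
Qed.

Lemma joins_lam_choice s S : st (C s) S ->
  joins st (image Lam S) (C (Lam s)).
Proof.
  intros HS. apply st_C_inv in HS as (S' & HS & ->).
  eapply covers_step; [apply st_C, st_lam, HS|].
  intros r (r1 & (s1 & Hs & ->) & ->).
  apply joins_reached with (Lam (C s1)).
  - exists (C s1). split; [|reflexivity]. now exists s1.
  - eexists. split; [apply st_lam_C|reflexivity].
Qed.
End Choice.

Lemma st_chl_inv s S : st (ChL s) S -> exists S', st s S' /\ S = image ChL S'.
Proof. intros H. inversion H; subst. eauto. Qed.

Lemma st_chr_inv s S : st (ChR s) S -> exists S', st s S' /\ S = image ChR S'.
Proof. intros H. inversion H; subst. eauto. Qed.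

Lemma closed_image {A B} (redA : A -> (A -> Prop) -> Prop)
  (redB : B -> (B -> Prop) -> Prop) (f : A -> B) :
  (forall a S, redA a S -> redB (f a) (image f S)) ->
  forall a S, redA a S ->
    exists S', redB (f a) S' /\ forall b, S' b <-> image f S b.
Proof. intros Hf a S H. exists (image f S). split; [auto|reflexivity]. Qed.

(** The genuine critical pairs oppose a root redex to a step inside it. Two steps inside the same
    immediate component join by [joins_map], and steps in different elements of a list commute. *)
Lemma local_confluence :
  (forall t H, st t H -> forall T t1, st t T -> T t1 -> joins st H t1) /\
  (forall ts H, sts ts H -> forall T ts1, sts ts T -> T ts1 -> joins sts H ts1).
Proof.
  apply st_sts_ind.
  - intros s ts T t1. apply beta_joins.
  - intros s ts T t1 HT Ht. inversion HT as [| | | | | |? ? T0 HT0| |]; subst.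
    + now apply joins_same.
    + destruct Ht as (s' & ts' & Ht & ->).
      eapply (app_choice_joins ChL); eauto using st, st_chl_inv.
  - intros s ts T t1 HT Ht. inversion HT as [| | | | | |? ? T0 HT0| |]; subst.
    + now apply joins_same.
    + destruct Ht as (s' & ts' & Ht & ->).
      eapply (app_choice_joins ChR); eauto using st, st_chr_inv.
  - intros s T t1 HT Ht. inversion HT as [| | | | |? S HS| | |]; subst.
    + now apply joins_same.
    + destruct Ht as (s' & Hs & ->).
      eapply (lam_choice_joins ChL); eauto using st, st_chl_inv.
  - intros s T t1 HT Ht. inversion HT as [| | | | |? S HS| | |]; subst.
    + now apply joins_same.
    + destruct Ht as (s' & Hs & ->).
      eapply (lam_choice_joins ChR); eauto using st, st_chr_inv.
  - intros s H HH IH T t1 HT Ht.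
    inversion HT as [| | |s0|s0|? S HS| | |]; subst.
    + subst t1. eapply (joins_lam_choice ChL); eauto using st, st_chl_inv.
    + subst t1. eapply (joins_lam_choice ChR); eauto using st, st_chr_inv.
    + destruct Ht as (s' & Hs & ->).
      refine (joins_map st st Lam _ _ _ _ _ (IH _ _ HS Hs));
        [apply closed_image; constructor; assumption|].
      intros h Hh. now exists h.
  - intros s ts H HH IH T t1 HT Ht.
    inversion HT as [s0|s0|s0| | | |? ? T0 HT0| |]; subst.
    + now apply joins_beta with (1 := HH).
    + subst t1. eapply (joins_app_choice ChL); eauto using st, st_chl_inv.
    + subst t1. eapply (joins_app_choice ChR); eauto using st, st_chr_inv.
    + destruct Ht as (s' & ts' & Ht & ->).
      apply (joins_map sts st app_list st_app_list) with (2 := IH _ _ HT0 Ht).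
      intros [|s1 ts1] Hh; [|simpl; eauto].
      inversion HH; subst; now destruct Hh as (? & ? & ?).
  - intros s H HH IH T t1 HT Ht. apply st_chl_inv in HT as (S & HS & ->).
    destruct Ht as (s' & Hs & ->).
    refine (joins_map st st ChL _ _ _ _ _ (IH _ _ HS Hs));
        [apply closed_image; constructor; assumption|].
    intros h Hh. now exists h.
  - intros s H HH IH T t1 HT Ht. apply st_chr_inv in HT as (S & HS & ->).
    destruct Ht as (s' & Hs & ->).
    refine (joins_map st st ChR _ _ _ _ _ (IH _ _ HS Hs));
        [apply closed_image; constructor; assumption|].
    intros h Hh. now exists h.
  - intros t ts H HH IH T ts1 HT Ht.
    inversion HT as [? ? S HS|? ? T0 HT0]; subst; destruct Ht as (x & Hx & ->).
    + refine (joins_map st sts (fun t' => t' :: ts) _ _ _ _ _ (IH _ _ HS Hx)).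
      * apply closed_image. intros; now apply sts_head.
      * intros h Hh. now exists h.
    + eapply covers_step; [apply sts_head, HH|]. intros l (t' & Ht' & ->).
      apply joins_reached with (t' :: ts); [now exists t'|].
      eexists. split; [apply sts_tail, HT0|]. now exists x.
  - intros t ts H HH IH T ts1 HT Ht.
    inversion HT as [? ? S HS|? ? T0 HT0]; subst; destruct Ht as (x & Hx & ->).
    + eapply covers_step; [apply sts_tail, HH|]. intros l (t' & Ht' & ->).
      apply joins_reached with (t :: t'); [now exists t'|].
      eexists. split; [apply sts_head, HS|]. now exists x.
    + refine (joins_map sts sts (cons t) _ _ _ _ _ (IH _ _ HT0 Hx)).
      * apply closed_image. intros; now apply sts_tail.
      * intros h Hh. now exists h.
Qed.

Definition tlt (t' t : term) : Prop := elt (Term t') (Term t).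

Lemma tlt_wf : well_founded tlt.
Proof. exact (wf_inverse_image _ _ elt Term elt_wf). Qed.

Lemma st_tlt t S t' : st t S -> S t' -> tlt t' t.
Proof.
  intros HS Ht. apply (proj1 st_tred) in HS as (T & HT & E).
  exact (proj1 red_decreases _ _ HT _ (E _ Ht)).
Qed.

Definition tnormal (t : term) : Prop := forall S, ~ st t S.

Lemma steps_inv {A} red (a b : A) : steps red a b ->
  a = b \/ exists S c, red a S /\ S c /\ steps red c b.
Proof.
  intros H. apply clos_rt_rt1n in H. inversion H as [|c ? (S & HS & Sc) H']; subst.
  - now left.
  - right. exists S, c. split; [exact HS|]. split; [exact Sc|].
    now apply clos_rt1n_rt.
Qed.

(* Newman's argument, with reachability of [n] in place of convertibility. *)
Lemma reach_invariant t : forall n H, tnormal n -> st t H -> steps st t n ->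
  exists h, H h /\ steps st h n.
Proof.
  induction t as [t IH] using (well_founded_induction tlt_wf).
  intros n H Hn HH Hs. apply steps_inv in Hs as [->|(S & t1 & HS & Ht1 & Hs)].
  - now apply Hn in HH.
  - pose proof (proj1 local_confluence _ _ HH _ _ HS Ht1) as HJ.
    assert (L : tlt t1 t) by now apply st_tlt with S.
    clear S HS Ht1. induction HJ as [t1 (h & Hh & Hr)|t1 S HS _ IHJ].
    + exists h. split; [exact Hh|]. eapply rt_trans; eassumption.
    (* The outer hypothesis at [t1] exchanges its path to [n] for one that starts with the step used
       by the covering; the covering is then followed at the summand [t2] reached this way, still
       below [t]. *)
    + destruct (IH _ L _ _ Hn HS Hs) as (t2 & Ht2 & Hs2).
      apply IHJ with t2; [exact Ht2|exact Hs2|].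
      assert (L2 : tlt t2 t1) by now apply st_tlt with S.
      revert L L2. unfold tlt, elt, lex. lia.
Qed.
(** * Coherence *)

Lemma mcoh_iff ts ts' : mcoh ts ts' <->
  forall t u, In t (ts ++ ts') -> In u (ts ++ ts') -> tcoh t u.
Proof. split; [intros []; assumption|apply mcoh_intro]. Qed.

Lemma mcoh_incl us us' vs vs' : mcoh us us' ->
  incl vs (us ++ us') -> incl vs' (us ++ us') -> mcoh vs vs'.
Proof.
  rewrite !mcoh_iff. intros H I I' t u Ht Hu.
  apply H; apply (incl_app I I'); assumption.
Qed.

Section TcohInd.
Context (P : term -> term -> Prop).

(** For bags the hypothesis is given on all pairs from [ts ++ ts'], pairs on one side included,
    since two summands may distribute or match the elements in any way. *)
Lemma tcoh_nested_ind :
  (forall i, P (Var i) (Var i)) ->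
  (forall s s', tcoh s s' -> P s s' -> P (Lam s) (Lam s')) ->
  (forall s s' ts ts', tcoh s s' -> P s s' -> mcoh ts ts' ->
     (forall t u, In t (ts ++ ts') -> In u (ts ++ ts') -> P t u) ->
     P (App s ts) (App s' ts')) ->
  (forall s s', tcoh s s' -> P s s' -> P (ChL s) (ChL s')) ->
  (forall s s', tcoh s s' -> P s s' -> P (ChR s) (ChR s')) ->
  (forall s s', P (ChL s) (ChR s')) ->
  (forall s s', P (ChR s) (ChL s')) ->
  forall t t', tcoh t t' -> P t t'.
Proof.
  intros HV HL HA Hl Hr Hlr Hrl. fix IH 3. intros t t' H.
  destruct H as [i|s s' H|s s' ts ts' H [us us' Hs]|s s' H|s s' H|s s'|s s'];
    auto.
  apply HA; auto. now constructor.
Qed.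
End TcohInd.

Lemma tcoh_lift t t' : tcoh t t' -> forall c, tcoh (lift c t) (lift c t').
Proof.
  intros H. induction H using tcoh_nested_ind; intros c; simpl;
    constructor; auto.
  apply mcoh_iff. rewrite <- map_app. intros t u Ht Hu.
  apply in_map_iff in Ht as (t0 & <- & Ht). apply in_map_iff in Hu as (u0 & <- & Hu).
  auto.
Qed.

Lemma mcoh_lift c ts ts' : mcoh ts ts' -> mcoh (map (lift c) ts) (map (lift c) ts').
Proof.
  rewrite !mcoh_iff, <- map_app. intros H t u Ht Hu.
  apply in_map_iff in Ht as (t0 & <- & Ht). apply in_map_iff in Hu as (u0 & <- & Hu).
  apply tcoh_lift. auto.
Qed.

Lemma dsubs_in x ts us rs r : dsubs x ts us rs -> In r rs ->
  exists t vs, In t ts /\ incl vs us /\ dsub x t vs r.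
Proof.
  revert us rs. induction ts as [|t ts IH]; intros us rs H Hr;
    inversion H as [|? ? ? ? u1 u2 r0 rs0 E H1 H2]; subst; [easy|].
  assert (I : incl (u1 ++ u2) us)
    by (intros a Ha; now apply (Permutation_in _ (Permutation_sym E))).
  destruct Hr as [->|Hr].
  - exists t, u1. split; [now left|]. split; [|exact H1].
    intros a Ha. apply I, in_or_app. now left.
  - destruct (IH _ _ H2 Hr) as (t' & vs & Ht & Iv & Hd).
    exists t', vs. split; [now right|]. split; [|exact Hd].
    intros a Ha. apply I, in_or_app. right. auto.
Qed.

(** At a variable, the results are either the same variable or two elements of the substituted bags,
    coherent by hypothesis. *)
Lemma dsub_tcoh s s' : tcoh s s' -> forall x us us' r r', mcoh us us' ->
  dsub x s us r -> dsub x s' us' r' -> tcoh r r'.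
Proof.
  intros H. induction H as [i|s s' _ IH|s s' ts ts' _ IH _ IHs|s s' _ IH
    |s s' _ IH|s s'|s s'] using tcoh_nested_ind; intros x us us' r r' C H1 H2.
  - inversion H1; subst; inversion H2; subst; try contradiction.
    + rewrite mcoh_iff in C. apply C; simpl; auto.
    + constructor.
  - inversion H1; subst; inversion H2; subst. constructor.
    eapply IH; [|eassumption..]. now apply mcoh_lift.
  - inversion H1 as [| | |? ? ? ? r0 rs H3| |]; subst.
    inversion H2 as [| | |? ? ? ? r0' rs' H4| |]; subst.
    inversion H3 as [|? ? ? ? u1 u2 ? ? E H5 H6]; subst.
    inversion H4 as [|? ? ? ? u1' u2' ? ? E' H7 H8]; subst.
    assert (I : incl (u1 ++ u2) us)
      by (intros a Ha; now apply (Permutation_in _ (Permutation_sym E))).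
    assert (I' : incl (u1' ++ u2') us')
      by (intros a Ha; now apply (Permutation_in _ (Permutation_sym E'))).
    apply incl_app_inv in I as [I1 I2]. apply incl_app_inv in I' as [I1' I2'].
    constructor.
    + eapply IH; [|eassumption..]. apply (mcoh_incl _ _ _ _ C);
        [now apply incl_appl|now apply incl_appr].
    (* Both sides are traced back at once into [ts ++ ts'] and [us ++ us']: coherence of the
       resulting bags also compares two elements of the same side. *)
    + assert (Hin : forall q, In q (rs ++ rs') -> exists t vs,
        In t (ts ++ ts') /\ incl vs (us ++ us') /\ dsub x t vs q).
      { intros q Hq. apply in_app_or in Hq as [Hq|Hq].
        - destruct (dsubs_in _ _ _ _ _ H6 Hq) as (t & vs & Ht & Iv & Hd).
          exists t, vs. split; [apply in_or_app; auto|]. split; [|exact Hd].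
          apply incl_appl. eapply incl_tran; eassumption.
        - destruct (dsubs_in _ _ _ _ _ H8 Hq) as (t & vs & Ht & Iv & Hd).
          exists t, vs. split; [apply in_or_app; auto|]. split; [|exact Hd].
          apply incl_appr. eapply incl_tran; eassumption. }
      apply mcoh_iff. intros q q' Hq Hq'.
      apply Hin in Hq as (t & vs & Ht & Iv & Hd).
      apply Hin in Hq' as (t' & vs' & Ht' & Iv' & Hd').
      eapply IHs; [exact Ht|exact Ht'| |eassumption..].
      exact (mcoh_incl _ _ _ _ C Iv Iv').
  - inversion H1; subst; inversion H2; subst. constructor. eauto.
  - inversion H1; subst; inversion H2; subst. constructor. eauto.
  - inversion H1; subst; inversion H2; subst. constructor.
  - inversion H1; subst; inversion H2; subst. constructor.
Qed.

(** * Recovering the substituted terms from a result *)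

Lemma teq_lift_inv t : forall t' c, teq (lift c t) (lift c t') -> teq t t'.
Proof.
  induction t as [i|s IH|s ts IH IHs|s IH|s IH] using term_nested_ind;
    intros [j|s'|s' ts'|s'|s'] c H; simpl in H; inversion H; subst.
  - assert (i = j) as -> by (case_ltb; lia). reflexivity.
  - constructor. eauto.
  - constructor; [eauto|].
    (* [PermutationA] is cut into a literal permutation, which pulls back through [map], followed by
       an elementwise [teq]. *)
    apply (PermutationA_decompose teq_equiv) in H5 as (l & E & H5).
    apply Permutation_sym, Permutation_map_inv in E as (m & -> & E).
    transitivity m; [now apply Permutation_PermutationA; [apply teq_equiv|]|].
    assert (IHm : Forall (fun t => forall t' c,
        teq (lift c t) (lift c t') -> teq t t') m).
    { revert IHs. apply Permutation_Forall. exact E. }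
    apply eqlistA_PermutationA.
    clear - H5 IHm. revert ts' H5. induction IHm as [|t m Ht _ IH];
      intros [|t' ts'] H; inversion H; subst; constructor; eauto.
  - constructor. eauto.
  - constructor. eauto.
Qed.

Lemma permutationA_lift_inv c ts ts' :
  PermutationA teq (map (lift c) ts) (map (lift c) ts') -> PermutationA teq ts ts'.
Proof.
  (* The bags are wrapped in an application to which injectivity of [lift] on terms applies. *)
  intros H. assert (E : teq (lift c (App (Var 0) ts)) (lift c (App (Var 0) ts')))
    by (constructor; [reflexivity|exact H]).
  apply teq_lift_inv in E. now inversion E.
Qed.

(** Injectivity is assumed for every element of [ts] against every element of [ts']: equal results
    may pair them arbitrarily, and coherence of bags provides all the pairs. *)
Lemma dsubs_eqlistA_inj x ts ts' us us' rs rs' :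
  (forall t t' vs vs' r r', In t ts -> In t' ts' ->
     dsub x t vs r -> dsub x t' vs' r' -> teq r r' ->
     teq t t' /\ PermutationA teq vs vs') ->
  dsubs x ts us rs -> dsubs x ts' us' rs' -> eqlistA teq rs rs' ->
  PermutationA teq ts ts' /\ PermutationA teq us us'.
Proof.
  intros Hinj H H' E. revert ts ts' us us' Hinj H H'.
  induction E as [|r r' rs rs' Er _ IH]; intros ts ts' us us' Hinj H H'.
  - inversion H; subst. inversion H'; subst. split; constructor.
  - inversion H as [|? t ts0 ? u1 u2 ? ? E H1 H2]; subst.
    inversion H' as [|? t' ts0' ? u1' u2' ? ? E' H1' H2']; subst.
    destruct (Hinj t t' _ _ _ _ (or_introl eq_refl) (or_introl eq_refl) H1 H1' Er)
      as [Et Eu].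
    destruct (IH ts0 ts0' u2 u2') as [Ets Eus]; [|assumption..|].
    { intros. eapply Hinj; [now right|now right|eassumption..]. }
    split; [now constructor|].
    transitivity (u1 ++ u2); [now apply (Permutation_PermutationA teq_equiv)|].
    transitivity (u1' ++ u2').
    + now apply (PermutationA_app teq_equiv).
    + symmetry. now apply (Permutation_PermutationA teq_equiv).
Qed.

Lemma dsub_inj s s' : tcoh s s' -> forall x us us' r r',
  dsub x s us r -> dsub x s' us' r' -> teq r r' ->
  teq s s' /\ PermutationA teq us us'.
Proof.
  intros H. induction H as [i|s s' _ IH|s s' ts ts' _ IH _ IHs|s s' _ IH
    |s s' _ IH|s s'|s s'] using tcoh_nested_ind; intros x us us' r r' H1 H2 E.
  - inversion H1; subst; inversion H2; subst; try contradiction;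
      (split; [reflexivity|]); constructor; auto; constructor.
  - inversion H1; subst; inversion H2; subst. inversion E; subst.
    edestruct IH as [Es Eu]; [eassumption..|]. split; [now constructor|].
    now apply permutationA_lift_inv in Eu.
  - inversion H1 as [| | |? ? ? ? r0 rs H3| |]; subst.
    inversion H2 as [| | |? ? ? ? r0' rs' H4| |]; subst.
    inversion H3 as [|? ? ? ? u1 u2 ? ? Eu H5 H6]; subst.
    inversion H4 as [|? ? ? ? u1' u2' ? ? Eu' H7 H8]; subst.
    inversion E as [| |? ? ? ? E0 Es| |]; subst.
    destruct (IH _ _ _ _ _ H5 H7 E0) as [A1 A2].
    apply (PermutationA_decompose teq_equiv) in Es as (m & Em & Es).
    (* The permutation matching the two result bags is transferred to [ts], after which the results
       agree position by position. *)
    destruct (dsubs_perm_results _ _ _ _ _ Em H6) as (tm & Etm & H6').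
    destruct (dsubs_eqlistA_inj _ _ _ _ _ _ _
      (fun t t' vs vs' q q' Ht Ht' => IHs t t'
         (in_or_app _ _ _ (or_introl (Permutation_in _ (Permutation_sym Etm) Ht)))
         (in_or_app _ _ _ (or_intror Ht')) x vs vs' q q') H6' H8 Es) as [B1 B2].
    split.
    + constructor; [exact A1|]. transitivity tm; [|exact B1].
      now apply (Permutation_PermutationA teq_equiv).
    + transitivity (u1 ++ u2); [now apply (Permutation_PermutationA teq_equiv)|].
      transitivity (u1' ++ u2').
      * now apply (PermutationA_app teq_equiv).
      * symmetry. now apply (Permutation_PermutationA teq_equiv).
  - inversion H1; subst; inversion H2; subst. inversion E; subst.
    edestruct IH as [Es Eu]; [eassumption..|]. split; [now constructor|assumption].
  - inversion H1; subst; inversion H2; subst. inversion E; subst.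
    edestruct IH as [Es Eu]; [eassumption..|]. split; [now constructor|assumption].
  - inversion H1; subst; inversion H2; subst. inversion E.
  - inversion H1; subst; inversion H2; subst. inversion E.
Qed.

(** * Head reduction of coherent terms *)

Fixpoint neutral (t : term) : Prop :=
  match t with Var _ => True | App s _ => neutral s | _ => False end.

Fixpoint lam_neutral (t : term) : Prop :=
  match t with Lam s => lam_neutral s | _ => neutral t end.

(* Reduction keeps a choice at the root, so nothing is required below it. *)
Definition head_normal (t : term) : Prop :=
  match t with ChL _ | ChR _ => True | _ => lam_neutral t end.

(** A step from such a term takes place inside a bag of its spine, and these predicates do not look
    into bags. *)
Lemma neutral_st s : forall S s', st s S -> S s' ->
  (neutral s -> neutral s') /\ (lam_neutral s -> lam_neutral s').
Proof.
  induction s as [i|s IH|s ts IH _|s IH|s IH] using term_nested_ind;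
    intros S s' H Hs; simpl; try tauto.
  - inversion H.
  - split; [easy|]. inversion H; subst; simpl; try easy.
    destruct Hs as (s1 & Hs & ->). simpl. now apply (IH S0).
  - enough (neutral s -> neutral s' /\ lam_neutral s') by tauto. intros N.
    inversion H as [| | | | | |? ? T HT| |]; subst; try easy.
    destruct Hs as (s1 & ts1 & Hs & ->).
    inversion HT as [? ? S0 HS|? ? T0 HT0]; subst.
    + destruct Hs as (s2 & Hs & E). injection E as -> ->.
      simpl. split; now apply (IH _ _ HS Hs).
    + destruct Hs as (ts2 & Hs & E). injection E as -> ->. simpl. auto.
Qed.

(** Coherence passes down to the summands and equality comes back up. All pairs of summands are
    included, as it is not known which ones lead to the common normal form. *)
Definition head_step_coherent (t t' : term) : Prop :=
  exists S S', st t S /\ st t' S' /\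
    forall u u', S u -> S' u' -> tcoh u u' /\ (teq u u' -> teq t t').

(** Coherent terms have the same spine down to the first choice, so their head redexes are of the
    same kind. If the choices there are opposite, moving them outwards keeps them opposite, and the
    implication between equalities is vacuous. *)
Lemma tcoh_head t t' : tcoh t t' ->
  head_step_coherent t t' \/ (head_normal t /\ head_normal t').
Proof.
  intros H. induction H as [i|s s' H IH|s s' ts ts' H IH Hs|s s' H IH
    |s s' H IH|s s'|s s']; simpl; auto.
  - destruct IH as [(S & S' & HS & HS' & HC)|[N N']].
    + left. eexists. eexists. split; [constructor; exact HS|].
      split; [constructor; exact HS'|].
      intros u u' (v & Hv & ->) (v' & Hv' & ->). destruct (HC _ _ Hv Hv') as [C E].
      split; [now constructor|]. intros E'. inversion E'; subst.
      constructor. auto.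
    (* With head-normal bodies, the abstractions are head normal themselves unless the bodies are
       choices, which then move out. *)
    + destruct H; simpl in *; auto; left; eexists; eexists;
        (split; [constructor|]); (split; [constructor|]);
        intros u u' <- <-; (split; [now repeat constructor|]);
        intros E; inversion E as [| | |? ? E'|? ? E']; subst;
        inversion E'; subst; now repeat constructor.
  - destruct IH as [(S & S' & HS & HS' & HC)|[N N']].
    + left. eexists. eexists. split; [apply st_app, sts_head, HS|].
      split; [apply st_app, sts_head, HS'|].
      intros u u' (v & l & (v0 & Hv & E) & ->) (v' & l' & (v0' & Hv' & E') & ->).
      injection E as -> ->. injection E' as -> ->.
      destruct (HC _ _ Hv Hv') as [C E].
      split; [now constructor|]. intros E'. inversion E'; subst.
      constructor; auto.
    + destruct H as [i|s s' H|s s' us us' H Hu|s s' H|s s' H|s s'|s s'];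
        simpl in *; auto; left; eexists; eexists;
        (split; [constructor|]); (split; [constructor|]).
      * intros u u' Hu Hu'. split; [eapply dsub_tcoh; eassumption|].
        intros E. destruct (dsub_inj _ _ H _ _ _ _ _ Hu Hu' E).
        constructor; [constructor|]; assumption.
      * intros u u' <- <-. split; [now apply tcoh_chl, tcoh_app|].
        intros E. inversion E as [| | |? ? E'|]; subst. inversion E'; subst.
        constructor; [constructor|]; assumption.
      * intros u u' <- <-. split; [now apply tcoh_chr, tcoh_app|].
        intros E. inversion E as [| | | |? ? E']; subst. inversion E'; subst.
        constructor; [constructor|]; assumption.
      * intros u u' <- <-. split; [apply tcoh_chlr|]. intros E. inversion E.
      * intros u u' <- <-. split; [apply tcoh_chrl|]. intros E. inversion E.
Qed.

(** * Reductions starting from head-normal terms *)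

Lemma steps_chl_inv s n : steps st (ChL s) n ->
  exists n', n = ChL n' /\ steps st s n'.
Proof.
  intros H. apply clos_rt_rt1n in H. remember (ChL s) as t eqn:E. revert s E.
  induction H as [t|t u n (S & HS & Hu) _ IH]; intros s ->.
  - exists s. split; [reflexivity|]. apply rt_refl.
  - apply st_chl_inv in HS as (S' & HS & ->). destruct Hu as (s' & Hs & ->).
    destruct (IH s' eq_refl) as (n' & -> & H). exists n'. split; [reflexivity|].
    eapply rt_trans; [|exact H]. apply rt_step. now exists S'.
Qed.

Lemma steps_chr_inv s n : steps st (ChR s) n ->
  exists n', n = ChR n' /\ steps st s n'.
Proof.
  intros H. apply clos_rt_rt1n in H. remember (ChR s) as t eqn:E. revert s E.
  induction H as [t|t u n (S & HS & Hu) _ IH]; intros s ->.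
  - exists s. split; [reflexivity|]. apply rt_refl.
  - apply st_chr_inv in HS as (S' & HS & ->). destruct Hu as (s' & Hs & ->).
    destruct (IH s' eq_refl) as (n' & -> & H). exists n'. split; [reflexivity|].
    eapply rt_trans; [|exact H]. apply rt_step. now exists S'.
Qed.

(** As [lam_neutral] is preserved, no choice ever appears directly below the abstraction, so the
    abstraction stays at the root. *)
Lemma steps_lam_inv s n : lam_neutral s -> steps st (Lam s) n ->
  exists n', n = Lam n' /\ steps st s n'.
Proof.
  intros N H. apply clos_rt_rt1n in H. remember (Lam s) as t eqn:E. revert s E N.
  induction H as [t|t u n (S & HS & Hu) _ IH]; intros s -> N.
  - exists s. split; [reflexivity|]. apply rt_refl.
  - inversion HS as [| | |s0|s0|? S' HS'| | |]; subst; try easy.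
    destruct Hu as (s' & Hs & ->).
    destruct (IH s' eq_refl) as (n' & -> & H);
      [now apply (neutral_st _ _ _ HS' Hs)|].
    exists n'. split; [reflexivity|].
    eapply rt_trans; [|exact H]. apply rt_step. now exists S'.
Qed.

Lemma steps_refl_list ts : Forall2 (steps st) ts ts.
Proof. induction ts; constructor; auto. apply rt_refl. Qed.

Lemma steps_trans_list ts us vs :
  Forall2 (steps st) ts us -> Forall2 (steps st) us vs -> Forall2 (steps st) ts vs.
Proof.
  intros H. revert vs. induction H as [|t u ts us Ht _ IH]; intros vs H';
    inversion H'; subst; constructor; auto. eapply rt_trans; eassumption.
Qed.

Lemma sts_steps ts T ts' : sts ts T -> T ts' -> Forall2 (steps st) ts ts'.
Proof.
  intros HT Ht. apply sts_split in HT as (a & t & b & S & -> & HS & E).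
  apply E in Ht as (t' & Ht & ->). apply Forall2_app; [apply steps_refl_list|].
  constructor; [|apply steps_refl_list]. apply rt_step. now exists S.
Qed.

(** A neutral function never becomes an abstraction or a choice, so the application never turns into
    a redex. *)
Lemma steps_app_inv s ts n : neutral s -> steps st (App s ts) n ->
  exists n' ns, n = App n' ns /\ steps st s n' /\ Forall2 (steps st) ts ns.
Proof.
  intros N H. apply clos_rt_rt1n in H. remember (App s ts) as t eqn:E.
  revert s ts E N.
  induction H as [t|t u n (S & HS & Hu) _ IH]; intros s ts -> N.
  - exists s, ts. split; [reflexivity|]. split; [apply rt_refl|apply steps_refl_list].
  - inversion HS as [| | | | | |? ? T HT| |]; subst; try easy.
    destruct Hu as (s' & ts' & Hs & ->).
    pose proof (sts_steps _ _ _ HT Hs) as Hst.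
    inversion Hst as [|? ? ? ? H1 H2]; subst.
    destruct (IH s' ts' eq_refl) as (n' & ns & -> & Hn & Hns).
    { inversion HT as [? ? S0 HS0|? ? T0 HT0]; subst.
      - destruct Hs as (s2 & Hs & E). injection E as -> ->.
        now apply (neutral_st _ _ _ HS0 Hs).
      - destruct Hs as (ts2 & Hs & E). injection E as -> ->. exact N. }
    exists n', ns. split; [reflexivity|].
    split; [eapply rt_trans; eassumption|eapply steps_trans_list; eassumption].
Qed.

(** * Injectivity of normal forms on coherent expressions *)

Definition reach (t n : term) : Prop := steps st t n /\ tnormal n.

Lemma sts_of_st ns n S : In n ns -> st n S -> exists T, sts ns T.
Proof.
  intros Hi HS. induction ns as [|m ns IH]; [easy|]. destruct Hi as [->|Hi].
  - eexists. apply sts_head, HS.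
  - destruct (IH Hi) as (T & HT). eexists. apply sts_tail, HT.
Qed.

Lemma reach_list ts ns : Forall2 (steps st) ts ns ->
  (forall T, ~ sts ns T) -> Forall2 reach ts ns.
Proof.
  intros H N.
  assert (HN : forall n, In n ns -> tnormal n).
  { intros n Hn S HS. destruct (sts_of_st _ _ _ Hn HS) as (T & HT).
    exact (N T HT). }
  clear N. induction H as [|t n ts ns Ht _ IH]; constructor.
  - split; [exact Ht|]. apply HN. now left.
  - apply IH. intros. apply HN. now right.
Qed.

(** The permutation between the normal forms is carried back to [ts] along [reach]; as for
    substitution, any element may be paired with any other. *)
Lemma reach_list_inj ts ts' ns ns' :
  (forall t t' n n', In t ts -> In t' ts' -> reach t n -> reach t' n' ->
     teq n n' -> teq t t') ->
  Forall2 reach ts ns -> Forall2 reach ts' ns' -> PermutationA teq ns ns' ->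
  PermutationA teq ts ts'.
Proof.
  intros Hinj H H' E.
  apply (PermutationA_decompose teq_equiv) in E as (m & Em & E).
  apply Forall2_flip in H.
  destruct (Permutation_Forall2 Em H) as (tm & Etm & Hm).
  transitivity tm; [now apply (Permutation_PermutationA teq_equiv)|].
  assert (Hinj' : forall t t' n n', In t tm -> In t' ts' -> reach t n ->
    reach t' n' -> teq n n' -> teq t t').
  { intros t t' n n' Ht. apply Hinj.
    exact (Permutation_in _ (Permutation_sym Etm) Ht). }
  clear - H' E Hm Hinj'. apply Forall2_flip in Hm. simpl in Hm.
  revert tm ts' H' Hm Hinj'. induction E as [|n n' m ns' En _ IH];
    intros tm ts' H' Hm Hinj; inversion H'; subst; inversion Hm; subst;
    constructor.
  - eapply Hinj; [now left|now left|eassumption..].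
  - apply IH; [assumption..|]. intros. eapply Hinj; [now right|now right|eassumption..].
Qed.

Lemma tnormal_list s ns : tnormal (App s ns) -> forall T, ~ sts ns T.
Proof. intros N T HT. eapply N. apply st_app, sts_tail, HT. Qed.

(** One induction on [t] serves both cases: the measure drops along steps, and also from a term to
    its immediate subterms, whose [size] is smaller. The other term follows in parallel. *)
Lemma reach_inj t : forall t' n n', tcoh t t' -> reach t n -> reach t' n' ->
  teq n n' -> teq t t'.
Proof.
  induction t as [t IH] using (well_founded_induction tlt_wf).
  intros t' n n' C [Hs Hn] [Hs' Hn'] E.
  destruct (tcoh_head _ _ C) as [(S & S' & HS & HS' & HC)|[N N']].
  (* The given reductions are rerouted through the two coherent head steps. *)
  - destruct (reach_invariant _ _ _ Hn HS Hs) as (u & Hu & Hr).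
    destruct (reach_invariant _ _ _ Hn' HS' Hs') as (u' & Hu' & Hr').
    destruct (HC _ _ Hu Hu') as [Cu Eu]. apply Eu.
    apply (IH u) with n n'; [now apply st_tlt with S|exact Cu|now split..|exact E].
  - destruct C as [i|s s' C|s s' ts ts' C Cs|s s' C|s s' C|s s'|s s'];
      simpl in N, N'.
    + reflexivity.
    + apply steps_lam_inv in Hs as (m & -> & Hs); [|exact N].
      apply steps_lam_inv in Hs' as (m' & -> & Hs'); [|exact N'].
      inversion E; subst. constructor.
      apply (IH s) with m m'; auto.
      * left. simpl. lia.
      * split; [exact Hs|]. intros S HS. eapply Hn. constructor. exact HS.
      * split; [exact Hs'|]. intros S HS. eapply Hn'. constructor. exact HS.
    + apply steps_app_inv in Hs as (m & ms & -> & Hs & Hts); [|exact N].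
      apply steps_app_inv in Hs' as (m' & ms' & -> & Hs' & Hts'); [|exact N'].
      inversion E; subst. constructor.
      * apply (IH s) with m m'; auto.
        -- left. simpl. lia.
        -- split; [exact Hs|]. intros S HS. eapply Hn. apply st_app, sts_head, HS.
        -- split; [exact Hs'|]. intros S HS. eapply Hn'. apply st_app, sts_head, HS.
      * apply reach_list in Hts; [|now apply tnormal_list with m].
        apply reach_list in Hts'; [|now apply tnormal_list with m'].
        apply reach_list_inj with (2 := Hts) (3 := Hts'); [|assumption].
        intros t t' q q' Ht Ht'. apply IH.
        -- left. simpl. apply in_split in Ht as (a & b & ->).
           rewrite map_app, list_sum_app. simpl. lia.
        -- rewrite mcoh_iff in Cs. apply Cs; apply in_or_app; auto.
    + apply steps_chl_inv in Hs as (m & -> & Hs).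
      apply steps_chl_inv in Hs' as (m' & -> & Hs').
      inversion E; subst. constructor.
      apply (IH s) with m m'; auto.
      * left. simpl. lia.
      * split; [exact Hs|]. intros S HS. eapply Hn. constructor. exact HS.
      * split; [exact Hs'|]. intros S HS. eapply Hn'. constructor. exact HS.
    + apply steps_chr_inv in Hs as (m & -> & Hs).
      apply steps_chr_inv in Hs' as (m' & -> & Hs').
      inversion E; subst. constructor.
      apply (IH s) with m m'; auto.
      * left. simpl. lia.
      * split; [exact Hs|]. intros S HS. eapply Hn. constructor. exact HS.
      * split; [exact Hs'|]. intros S HS. eapply Hn'. constructor. exact HS.
    + apply steps_chl_inv in Hs as (m & -> & _).
      apply steps_chr_inv in Hs' as (m' & -> & _). inversion E.
    + apply steps_chr_inv in Hs as (m & -> & _).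
      apply steps_chl_inv in Hs' as (m' & -> & _). inversion E.
Qed.

(** * From sums of expressions to reachable normal terms *)

Definition esteps (e n : expr) : Prop :=
  match e, n with
  | Term t, Term n => steps st t n
  | Mono ts, Mono ns => Forall2 (steps st) ts ns
  | _, _ => False
  end.

Lemma red_esteps e E n : red e E -> In n E -> esteps e n.
Proof.
  intros [t S H|ts T H] Hn; apply in_map_iff in Hn as (x & <- & Hx); simpl.
  - apply tred_st in H as (P & HP & E'). apply rt_step. exists P.
    split; [exact HP|]. now apply E'.
  - apply tred_st in H as (P & HP & E'). apply sts_steps with P; [exact HP|].
    now apply E'.
Qed.

(** A step of a sum rewrites one summand, so every summand of the result descends from a single
    summand of the start, and sums can be left behind. *)
Lemma sreds_esteps E N : sreds E N ->
  forall n, In n N -> exists e, In e E /\ esteps e n.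
Proof.
  intros H. induction H as [E N [E1 e E2 E' H]|E|E N N' _ IH1 _ IH2]; intros n Hn.
  - apply in_app_or in Hn as [Hn|Hn]; [|apply in_app_or in Hn as [Hn|Hn]].
    + exists n. split; [apply in_or_app; now left|].
      destruct n; [apply rt_refl|apply steps_refl_list].
    + exists e. split; [apply in_or_app; right; now left|].
      exact (red_esteps _ _ _ H Hn).
    + exists n. split; [apply in_or_app; right; now right|].
      destruct n; [apply rt_refl|apply steps_refl_list].
  - exists n. split; [exact Hn|]. destruct n; [apply rt_refl|apply steps_refl_list].
  - apply IH2 in Hn as (m & Hm & H2). apply IH1 in Hm as (e & He & H1).
    exists e. split; [exact He|].
    destruct e, m, n; simpl in *; try easy;
      [eapply rt_trans|eapply steps_trans_list]; eassumption.
Qed.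

Definition ereach (e n : expr) : Prop :=
  match e, n with
  | Term t, Term n => reach t n
  | Mono ts, Mono ns => Forall2 reach ts ns
  | _, _ => False
  end.

(** A step of one element of a monomial is a step of the whole, so normality of the sum makes each
    element normal. *)
Lemma NF_ereach e n : In n (NF [e]) -> ereach e n.
Proof.
  intros Hn. destruct (NF_spec [e]) as [HS HN].
  destruct (sreds_esteps _ _ HS _ Hn) as (e' & [<-|[]] & He).
  rewrite normal_iff in HN. specialize (HN n).
  destruct e as [t|ts], n as [n|ns]; simpl in *; try easy.
  - split; [exact He|]. intros S H. apply st_tred in H as (T & HT & _).
    apply (HN (map Term T) Hn). now constructor.
  - apply reach_list; [exact He|]. intros T H. apply st_tred in H as (T' & HT & _).
    apply (HN (map Mono T') Hn). now constructor.
Qed.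

Theorem theorem6p8 : forall e e' : expr,
  coh e e' ->
  (exists u : expr, supp (NF [e]) u /\ supp (NF [e']) u) ->
  eeq e e'.
Proof.
  intros e e' C (u & (n & Hn & En) & (n' & Hn' & En')).
  apply NF_ereach in Hn, Hn'.
  assert (E : eeq n n') by (transitivity u; [|symmetry]; assumption).
  destruct C as [t t' C|ts ts' C].
  - destruct n as [n|], n' as [n'|]; try easy. inversion E; subst. constructor.
    exact (reach_inj _ _ _ _ C Hn Hn' H1).
  - destruct n as [|ns], n' as [|ns']; try easy. inversion E; subst. constructor.
    apply reach_list_inj with (2 := Hn) (3 := Hn'); [|assumption].
    intros t t' m m' Ht Ht'. apply reach_inj. rewrite mcoh_iff in C.
    apply C; apply in_or_app; auto.
Qed.
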